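(* Let $n\ge1$ and let $v,w\in S_n$ with $v\le w$ in Bruhat order. The ideal $\mathrm{in}(I_n)|_{T_w^v}$ is monomial-free (contains no monomial) if and only if $(v,w)\in\mathcal{T}_n$.
   Context: **Orders.** $[n]=\{1,\dots,n\}$; $w\in S_n$ is written $w=(w_1,\dots,w_n)$ with $w_i=w(i)$. For subsets of $[n]$: $\{i_1<\dots<i_s\}\le\{j_1<\dots<j_t\}$ if $s\ge t$ and $i_1\le j_1,\dots,i_t\le j_t$. Bruhat order on $S_n$: $v\le w$ if $\{v_1,\dots,v_k\}\le\{w_1,\dots,w_k\}$ for all $k\in[n]$. For a subset $I$ with $|I|=k$: $I\le w$ means $I\le\{w_1,\dots,w_k\}$, and $v\le I$ means $\{v_1,\dots,v_k\}\le I$. **Compatible pairs and $\mathcal{T}_n$.** For $w\in S_n$ ($n\ge2$) with $w_t=n$, the induced permutation is $\underline w=(w_1,\dots,w_{t-1},w_{t+1},\dots,w_n)\in S_{n-1}$. Let $v,w\in S_n$ with $n=v_t=w_{t'}$ and $n-1=v_s=w_{s'}$. The pair $(v,w)$ is compatible if either (i) $t=t'$, or (ii) $t'<t$ and $s'\le t$, $t'\le s$, $n=w_{t'}>w_{t'+1}>\dots>w_t$ and $n=v_t>v_{t-1}>\dots>v_{t'}$. Define $\mathcal{T}_1=\{(\mathrm{id},\mathrm{id})\}$ and $\mathcal{T}_{n+1}=\{(v,w)\in S_{n+1}\times S_{n+1}:(\underline v,\underline w)\in\mathcal{T}_n\text{ and }(v,w)\text{ is compatible}\}$. **Ideals.**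 $\mathbb{K}$ is an algebraically closed field. Let $X=(x_{i,j})$ be an $(n-1)\times n$ matrix of indeterminates. The Plücker ideal $I_n$ of the flag variety is the kernel of $\varphi_n:\mathbb{K}[P_J:\varnothing\ne J\subsetneq[n]]\to\mathbb{K}[x_{i,j}]$ sending $P_J$ to the minor of $X$ with rows $1,\dots,|J|$ and columns $J$. Give $x_{i,j}$ weight $M_{i,j}=(i-1)(n-j+1)$; give $P_J$, $J=\{j_1<\dots<j_k\}$, the weight of $\mathrm{in}_M(P_J)=x_{1,j_1}x_{2,j_2}\cdots x_{k,j_k}$ (the lowest-weight term of $\varphi_n(P_J)$). $\mathrm{in}(I_n)$ is the initial ideal of $I_n$ with respect to this weight on the $P_J$, where the initial form of a polynomial is the sum of its terms of lowest weight. It is known that $\mathrm{in}(I_n)$ is generated by quadratic binomials and equals the kernel of the monomial map $\phi_n:P_J\mapsto\mathrm{in}_M(P_J)$. **Restriction.** For $v\le w$ in $S_n$, $T_w^v$ is the set of non-empty proper subsets $J\subsetneq[n]$ with $v\le J\le w$. For an ideal $\langle G\rangle\subseteq\mathbb{K}[P_J:\varnothing\ne J\subsetneq[n]]$ and a collection $T$ of subsets, the restriction $\langle G\rangle|_T$ is the ideal of $\mathbb{K}[P_J:J\in T]$ generated by the polynomials obtained from those in $G$ by setting $P_J=0$ for all $J\notin T$; this is independent of the generating set $G$. *)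

(* Defs.v *)
From HB Require Import structures.
From mathcomp Require Import all_boot all_order all_algebra all_fingroup.
From mathcomp Require Import mpoly.

Set Implicit Arguments.
Unset Strict Implicit.
Unset Printing Implicit Defensive.

Import GRing.Theory.
Local Open Scope ring_scope.

(* Throughout, [n] is represented by 'I_n, the ordinal i standing for i + 1. *)

(* enum on 'I_n is increasing, so this lists A in increasing order. *)
Definition elts (n : nat) (A : {set 'I_n}) : seq nat :=
  [seq val i | i <- enum A].

Definition set_le (n : nat) (A B : {set 'I_n}) : bool :=
  (#|B| <= #|A|)%N &&
  all (fun r => nth 0 (elts A) r <= nth 0 (elts B) r)%N (iota 0 #|B|).

(* {w_1, ..., w_k} *)
Definition first_values (n : nat) (w : 'S_n) (k : nat) : {set 'I_n} :=
  [set w i | i in [set j : 'I_n | (j < k)%N]].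

Definition bruhat_le (n : nat) (v w : 'S_n) : bool :=
  [forall k : 'I_n, set_le (first_values v k.+1) (first_values w k.+1)].

Definition perm_le_set (n : nat) (v : 'S_n) (J : {set 'I_n}) : bool :=
  set_le (first_values v #|J|) J.

Definition set_le_perm (n : nat) (J : {set 'I_n}) (w : 'S_n) : bool :=
  set_le J (first_values w #|J|).

Definition max_pos (n : nat) (w : 'S_n.+1) : 'I_n.+1 := (w^-1)%g ord_max.

(* Delete the position of the maximal value; the default of odflt is never
   used, as lift_perm_induced shows. *)
Definition induced_fun (n : nat) (w : 'S_n.+1) (i : 'I_n) : 'I_n :=
  odflt i (unlift ord_max (w (lift (max_pos w) i))).

Lemma lift_induced_fun (n : nat) (w : 'S_n.+1) (i : 'I_n) :
  lift ord_max (induced_fun w i) = w (lift (max_pos w) i).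
Proof.
rewrite /induced_fun; case: unliftP => [j -> // | /= eq_max].
have /eqP := neq_lift (max_pos w) i; case.
by rewrite /max_pos -{1}eq_max permK.
Qed.

Lemma induced_fun_inj (n : nat) (w : 'S_n.+1) : injective (induced_fun w).
Proof.
move=> i j eq_ij; apply: (@lift_inj _ (max_pos w)); apply: (@perm_inj _ w).
by rewrite -!lift_induced_fun eq_ij.
Qed.

Definition induced (n : nat) (w : 'S_n.+1) : 'S_n :=
  perm (@induced_fun_inj n w).

Lemma lift_perm_induced (n : nat) (w : 'S_n.+1) :
  lift_perm (max_pos w) ord_max (induced w) = w.
Proof.
apply/permP => k; case: (unliftP (max_pos w) k) => [j -> | ->].
  by rewrite lift_perm_lift permE lift_induced_fun.
by rewrite lift_perm_id /max_pos permKV.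
Qed.

Definition submax_pos (n : nat) (w : 'S_n.+2) : 'I_n.+2 := (w^-1)%g (inord n).

Definition compatible (n : nat) (v w : 'S_n.+2) : bool :=
  let t := max_pos v in let t' := max_pos w in
  let s := submax_pos v in let s' := submax_pos w in
  (t == t') ||
  [&& (t' < t)%N, (s' <= t)%N, (t' <= s)%N,
      [forall i : 'I_n.+2, forall j : 'I_n.+2,
         [&& t' <= i, i < j & j <= t]%N ==> (w j < w i)%N]
    & [forall i : 'I_n.+2, forall j : 'I_n.+2,
         [&& t' <= i, i < j & j <= t]%N ==> (v i < v j)%N]].

(* The value at n = 0 is a dummy: the family starts at n = 1. *)
Fixpoint calT (n : nat) : 'S_n -> 'S_n -> bool :=
  match n return 'S_n -> 'S_n -> bool with
  | 0 => fun _ _ => false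
  | m.+1 =>
      match m return ('S_m -> 'S_m -> bool) -> 'S_m.+1 -> 'S_m.+1 -> bool with
      | 0 => fun _ _ _ => true
      | _.+1 => fun calTm v w =>
          calTm (induced v) (induced w) && compatible v w
      end (@calT m)
  end.

Notation "{ 'fpoly' K [ I ] }" := {mpoly K[#|{: I}|]}
  (at level 0, K, I at level 2, format "{ 'fpoly'  K [ I ] }").

Definition pvar (K : comNzRingType) (I : finType) (i : I) : {fpoly K[I]} :=
  'X_(enum_rank i).

Definition psubst (K : comNzRingType) (I I' : finType)
    (h : I -> {fpoly K[I']}) (f : {fpoly K[I]}) : {fpoly K[I']} :=
  f \mPo [tuple h (enum_val r) | r < #|{: I}|].

Lemma psubst_pvar (K : comNzRingType) (I I' : finType)
    (h : I -> {fpoly K[I']}) (i : I) : psubst h (pvar K i) = h i.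
Proof. by rewrite /psubst /pvar comp_mpolyXU -tnth_nth tnth_mktuple enum_rankK. Qed.

Definition mon_weight (I : finType) (wt : I -> nat) (m : 'X_{1..#|I|}) : nat :=
  \sum_(i : I) m (enum_rank i) * wt i.

Definition initial_form (K : comNzRingType) (I : finType) (wt : I -> nat)
    (f : {fpoly K[I]}) : {fpoly K[I]} :=
  \sum_(m <- msupp f |
        all (fun m' => mon_weight wt m <= mon_weight wt m')%N (msupp f))
     f@_m *: 'X_[m].

Definition ideal_gen (R : comNzRingType) (G : R -> Prop) (f : R) : Prop :=
  exists s : seq (R * R),
    (forall c, c \in s -> G c.2) /\ f = \sum_(c <- s) c.1 * c.2.

Definition initial_ideal (K : comNzRingType) (I : finType) (wt : I -> nat)
    (A : {fpoly K[I]} -> Prop) : {fpoly K[I]} -> Prop :=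
  ideal_gen (fun g => exists2 f, A f & g = initial_form wt f).

Definition monomial_free (K : comNzRingType) (I : finType)
    (A : {fpoly K[I]} -> Prop) : Prop :=
  forall m : 'X_{1..#|I|}, ~ A 'X_[m].

Definition restrict_poly (K : comNzRingType) (I : finType) (T : {set I}) :
    {fpoly K[I]} -> {fpoly K[{i : I | i \in T}]} :=
  psubst (fun i => if insub i is Some j then pvar K j else 0).

Definition restrict (K : comNzRingType) (I : finType)
    (G : {fpoly K[I]} -> Prop) (T : {set I}) :
    {fpoly K[{i : I | i \in T}]} -> Prop :=
  ideal_gen (fun g => exists2 f, G f & g = restrict_poly T f).
Arguments restrict {K I} G T g.

(* Restricting an ideal amounts to restricting any set of generators. *)
Lemma restrict_ideal_gen (K : comNzRingType) (I : finType)
    (G : {fpoly K[I]} -> Prop) (T : {set I}) (g : {fpoly K[{i : I | i \in T}]}) :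
  restrict (ideal_gen G) T g <-> restrict G T g.
Proof.
split=> -[s [sG ->]].
  have {}sG c : c \in s -> restrict G T c.2.
    move=> /sG[f [u [uG ->]] ->].
    exists [seq (restrict_poly T d.1, restrict_poly T d.2) | d <- u]; split.
      by move=> _ /mapP[d /uG dG ->]; exists d.2.
    rewrite big_map /restrict_poly /psubst raddf_sum.
    by apply: eq_bigr => d _; exact: rmorphM.
  elim: s sG => [|c s IHs] sG; first by exists [::]; rewrite !big_nil.
  have [c' [c'G def_c]] := sG c (mem_head c s).
  have [|s' [s'G def_s]] := IHs.
    by move=> d s_d; apply: sG; rewrite inE s_d orbT.
  exists ([seq (c.1 * d.1, d.2) | d <- c'] ++ s'); split.
    by move=> d; rewrite mem_cat => /orP[/mapP[e /c'G ? ->] | /s'G].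
  rewrite big_cons def_c def_s big_cat big_map mulr_sumr /=.
  by congr (_ + _); apply: eq_bigr => d _; rewrite mulrA.
exists s; split=> // c /sG[f Gf ->]; exists f => //.
exists [:: (1, f)]; split; last by rewrite big_seq1 mul1r.
by move=> d; rewrite inE => /eqP->.
Qed.

Definition psubset (n : nat) : Type :=
  {J : {set 'I_n} | (J != set0) && (J \proper [set: 'I_n])}.
HB.instance Definition _ (n : nat) := Finite.on (psubset n).

Lemma psubset_card (n : nat) (J : psubset n) : (#|val J| <= n.-1)%N.
Proof.
have /andP[_ /proper_card] := valP J.
by rewrite cardsT card_ord; case: n J => // n J; rewrite ltnS.
Qed.

(* The r-th entry of a k-subset J sits in column enum_val r, the r-th smallest
   element of J, and in row r, viewed as a row of an (n-1) x n matrix. *)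
Definition prow (n : nat) (J : psubset n) (r : 'I_#|val J|) : 'I_n.-1 :=
  widen_ord (psubset_card J) r.

Definition pcol (n : nat) (J : psubset n) (r : 'I_#|val J|) : 'I_n :=
  enum_val r.

Definition xmatrix (K : comNzRingType) (n : nat) :
    'M[{fpoly K['I_n.-1 * 'I_n]}]_(n.-1, n) :=
  \matrix_(i, j) pvar K (i, j).

Definition plucker_minor (K : comNzRingType) (n : nat) (J : psubset n) :
    {fpoly K['I_n.-1 * 'I_n]} :=
  \det (mxsub (@prow n J) (@pcol n J) (xmatrix K n)).

Definition plucker_map (K : comNzRingType) (n : nat) :
    {fpoly K[psubset n]} -> {fpoly K['I_n.-1 * 'I_n]} :=
  psubst (@plucker_minor K n).

Definition plucker_ideal (K : comNzRingType) (n : nat)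
    (f : {fpoly K[psubset n]}) : Prop :=
  plucker_map f = 0.

(* (i - 1)(n - j + 1) after shifting both indices by one *)
Definition Mweight (n : nat) (ij : 'I_n.-1 * 'I_n) : nat :=
  (ij.1 * (n - ij.2))%N.

(* the exponent of x_{1,j_1} x_{2,j_2} ... x_{k,j_k} *)
Definition diag_mon (n : nat) (J : psubset n) :
    'X_{1..#|{: 'I_n.-1 * 'I_n}|} :=
  (\sum_(r < #|val J|) U_(enum_rank (prow r, pcol r)))%MM.

Definition plucker_weight (n : nat) (J : psubset n) : nat :=
  mon_weight (@Mweight n) (diag_mon J).

Definition initial_plucker_ideal (K : comNzRingType) (n : nat) :
    {fpoly K[psubset n]} -> Prop :=
  initial_ideal (@plucker_weight n) (@plucker_ideal K n).

Definition Tset (n : nat) (v w : 'S_n) : {set psubset n} :=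
  [set J : psubset n | perm_le_set v (val J) && set_le_perm (val J) w].

(* Main.v *)
(* Write cnt J m for the number of elements of J below m.  The entries of J are
   governed by this function: v <= J <= w says that cnt J lies between the rank
   functions of w and v, and x_{r,x} divides the diagonal monomial of J exactly
   when x is in J and cnt J x = r.

   Necessity.  For i < j < k outside S, the lowest two terms of the three-term
   relation between P_{Si} P_{Sjk}, P_{Sj} P_{Sik} and P_{Sk} P_{Sij} are the
   first two, since only these have the same diagonal monomials.  Hence, if the
   restriction is monomial-free and T contains Sj and Sik, it contains Si and
   Sjk.  Applied to suitable initial segments of v and w this exchange property
   forces v to have left-to-right maxima, and w right-to-left maxima, between
   the positions of their largest value; this implies compatibility, and T is
   then described by the interval of the induced pair, which inherits the
   exchange property.

   Sufficiency.  For a pair in calT the same description of T, iterated, exhibits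
   T as the zero set of a nonnegative function of J that is linear in the
   exponents of the diagonal monomial.  So whether all variables of a monomial
   lie in T depends only on its image under the diagonal map, and a polynomial
   killed by this map is still killed after restriction to T. *)

Require Import Defs.
From mathcomp Require Import all_boot all_order all_algebra all_fingroup.
From mathcomp Require Import mpoly.
From mathcomp Require Import zify ring.

Set Implicit Arguments.
Unset Strict Implicit.
Unset Printing Implicit Defensive.

Import Order.TTheory GRing.Theory Num.Theory.

(** * Counting functions of subsets and permutations *)

Definition cnt (n : nat) (A : {set 'I_n}) (m : nat) : nat := \sum_(x in A) (x < m).

(** The rank function attached to Bruhat order. Both cutoffs are plain numbers and may exceed n, so
    that later statements need few bounds. *)
Definition rk (n : nat) (v : 'S_n) (k m : nat) : nat :=
  \sum_(i < n) ((i < k) && (v i < m)).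

Lemma cntU1 n (x : 'I_n) (A : {set 'I_n}) m :
  x \notin A -> cnt (x |: A) m = (x < m) + cnt A m.
Proof. by move=> xA; rewrite /cnt big_setU1. Qed.

Lemma cntD1 n (x : 'I_n) (A : {set 'I_n}) m :
  x \in A -> cnt A m = (x < m) + cnt (A :\ x) m.
Proof. by move=> xA; rewrite /cnt (big_setD1 x). Qed.

Lemma cnt_card n (A : {set 'I_n}) m : n <= m -> cnt A m = #|A|.
Proof.
move=> nm; rewrite /cnt -sum1_card; apply: eq_bigr => x _.
by rewrite (leq_trans (ltn_ord x) nm).
Qed.

Lemma leq_cnt n (A : {set 'I_n}) m m' : m <= m' -> cnt A m <= cnt A m'.
Proof.
move=> mm'; apply: leq_sum => x _.
by case: ltnP => // /leq_trans -> .
Qed.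

Lemma cnt_le_card n (A : {set 'I_n}) m : cnt A m <= #|A|.
Proof. by rewrite -sum1_card; apply: leq_sum => x _; case: ltnP. Qed.

Lemma cntS n (A : {set 'I_n}) (x : 'I_n) : cnt A x.+1 = cnt A x + (x \in A).
Proof.
have E m : cnt A m = \sum_(y < n) ((y \in A) && (y < m)).
  rewrite /cnt big_mkcond; apply: eq_bigr => y _; by case: (y \in A).
rewrite !E (bigD1 x) //= [in RHS](bigD1 x) //= ltnn ltnSn !andbT andbF add0n addnC.
congr (_ + _); apply: eq_bigr => y yx.
by rewrite ltnS leq_eqVlt (inj_eq val_inj) (negPf yx).
Qed.

Lemma cntS_ge n (A : {set 'I_n}) m : n <= m -> cnt A m.+1 = cnt A m.
Proof. by move=> nm; rewrite !cnt_card // leqW. Qed.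

Lemma cnt_lipschitz n (A : {set 'I_n}) m d : cnt A (m + d) <= cnt A m + d.
Proof.
elim: d => [|d IH]; first by rewrite !addn0.
rewrite addnS; case: (ltnP (m + d) n) => [lt|le].
  have := cntS A (Ordinal lt) => /= ->; case: (_ \in A); lia.
by rewrite cntS_ge //; lia.
Qed.

(** In an increasing list the entries below m form an initial segment; this turns entrywise
    comparison into comparison of counts. *)
Lemma ltn_count_sorted (s : seq nat) m r : sorted ltn s ->
  (r < count (fun x => x < m) s) = (r < size s) && (nth 0 s r < m).
Proof.
elim: s r => [|a s IH] r //= ps.
have [am | ma] := ltnP a m.
  case: r => [|r] /=; first by rewrite am.
  by rewrite add1n !ltnS IH // (path_sorted ps).
have all_s : all (fun x => m <= x) (a :: s).
  rewrite /= ma; apply/allP => x xs.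
  have := order_path_min ltn_trans ps => /allP/(_ x xs) ax.
  by rewrite (leq_trans ma) // ltnW.
have -> : count (fun x => x < m) s = 0.
  apply/eqP; rewrite -leqn0 leqNgt -has_count -all_predC.
  by case/andP: all_s => _; apply: sub_all => x /=; rewrite -leqNgt.
rewrite /= addn0 ltn0; apply/esym/negbTE; rewrite negb_and -!leqNgt orbC.
case: (ltnP r (size s).+1) => [rs|]; last by rewrite orbT.
by apply/orP; left; have /allP := all_s; apply; exact: (@mem_nth _ 0 (a :: s)).
Qed.

Lemma sorted_elts n (A : {set 'I_n}) : sorted ltn (elts A).
Proof.
rewrite /elts sorted_map.
apply: (subseq_sorted (leT := relpre val ltn) _ (s2 := enum 'I_n)).
- by move=> y x z; apply: ltn_trans.
- by rewrite {1}/enum_mem -enumT filter_subseq.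
- by rewrite -sorted_map val_enum_ord iota_ltn_sorted.
Qed.

Lemma size_elts n (A : {set 'I_n}) : size (elts A) = #|A|.
Proof. by rewrite size_map -cardE. Qed.

Lemma count_elts n (A : {set 'I_n}) m : count (fun x => x < m) (elts A) = cnt A m.
Proof.
rewrite /elts -sum1_count big_map big_enum_cond big_mkcondr /=.
by apply: eq_bigr => x _; case: (x < m).
Qed.

(** Smaller entries give larger counts, hence the reversal. Taking m = n recovers the cardinalities,
    and m one above the r-th entry of B recovers the comparison of r-th entries. *)
Lemma set_leP n (A B : {set 'I_n}) :
  reflect (forall m, cnt B m <= cnt A m) (set_le A B).
Proof.
have H m r X := @ltn_count_sorted _ m r (sorted_elts X).
apply: (iffP andP) => [[le_card /allP le_nth] m | le_cnt]; last split.
- rewrite -!count_elts; case E: (count _ _) => [|r] //.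
  move: (leqnn r.+1); rewrite -{2}E !H !size_elts => /andP[rB ltm].
  rewrite (leq_trans rB le_card) (leq_ltn_trans _ ltm) //.
  by apply: le_nth; rewrite mem_iota.
- by rewrite -(cnt_card B (leqnn n)) -(cnt_card A (leqnn n)).
- apply/allP => r; rewrite mem_iota => /= rB.
  have := le_cnt (nth 0 (elts B) r).+1.
  move/(leq_trans _) => /(_ r.+1); rewrite -!count_elts !H !size_elts ltnSn rB.
  by move=> /(_ isT) /andP[].
Qed.

Lemma cnt_first_values n (v : 'S_n) k m : cnt (first_values v k) m = rk v k m.
Proof.
rewrite /cnt /first_values big_imset /=; last by move=> i j _ _; exact: perm_inj.
rewrite big_mkcond; apply: eq_bigr => i _.
by rewrite inE; case: (i < k).
Qed.

Lemma rk_top n (v : 'S_n) k m : k <= n -> n <= m -> rk v k m = k.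
Proof.
move=> kn nm; rewrite -cnt_first_values cnt_card // card_imset; last exact: perm_inj.
rewrite -sum1_card (eq_bigl (fun j : 'I_n => j < k)); last by move=> j; rewrite inE.
by rewrite (big_ord_narrow kn) sum1_card card_ord.
Qed.

Lemma card_first_values n (v : 'S_n) k : k <= n -> #|first_values v k| = k.
Proof. by move=> kn; rewrite -(cnt_card _ (leqnn n)) cnt_first_values rk_top. Qed.

Lemma rkS n (v : 'S_n) (k : 'I_n) m : rk v k.+1 m = rk v k m + (v k < m).
Proof.
rewrite /rk (bigD1 k) //= [in RHS](bigD1 k) //= ltnn ltnSn /= add0n addnC.
congr (_ + _); apply: eq_bigr => y yx.
by rewrite ltnS leq_eqVlt (inj_eq val_inj) (negPf yx).
Qed.

Lemma rk_ge n (v : 'S_n) k m : n <= k -> rk v k m = rk v n m.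
Proof.
by move=> nk; apply: eq_bigr => i _; rewrite ltn_ord (leq_trans (ltn_ord i) nk).
Qed.

Lemma bruhatP n (v w : 'S_n) : 
  reflect (forall k m, rk w k m <= rk v k m) (bruhat_le v w).
Proof.
apply: (iffP forallP) => H k; last by apply/set_leP => m; rewrite !cnt_first_values.
move=> m; case: k => [|k].
  by rewrite /rk !big1 // => i; rewrite ltn0.
have [kn | nk] := ltnP k n.
  by have /set_leP/(_ m) := H (Ordinal kn); rewrite !cnt_first_values.
case: n => [|n] in v w H nk *; first by rewrite /rk !big_ord0.
by rewrite !(rk_ge _ _ (leqW nk)); have /set_leP/(_ m) := H ord_max;
   rewrite !cnt_first_values.
Qed.

(** Membership in T, extended to all subsets including the empty and the full one, so that the
    largest element can be removed from J in inductions on n. *)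
Definition inT n (v w : 'S_n) (J : {set 'I_n}) : Prop :=
  forall m, rk w #|J| m <= cnt J m <= rk v #|J| m.

Lemma TsetP n (v w : 'S_n) (J : psubset n) :
  J \in Tset v w <-> inT v w (val J).
Proof.
rewrite inE /perm_le_set /set_le_perm; split.
  case/andP => /set_leP H1 /set_leP H2 m.
  by rewrite -!cnt_first_values H1 H2.
by move=> H; apply/andP; split; apply/set_leP => m; rewrite cnt_first_values;
   case/andP: (H m).
Qed.

Lemma rk_total n (v : 'S_n) m : m <= n -> rk v n m = m.
Proof.
move=> mn; transitivity (\sum_(i < n) (i < m)).
  by rewrite [RHS](reindex_inj (@perm_inj _ v)); apply: eq_bigr => i _; rewrite ltn_ord.
by rewrite -big_mkcond (big_ord_narrow mn) sum1_card card_ord.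
Qed.

Lemma rk_full n (v : 'S_n) k m : k <= n ->
  (forall i : 'I_n, i < k -> v i < m) -> rk v k m = k.
Proof.
move=> kn lt_m; rewrite -[RHS](rk_top v kn (leqnn n)).
apply: eq_bigr => i _; rewrite ltn_ord andbT.
by case: ltnP => // /lt_m ->.
Qed.

(** Exactly m positions carry a value below m: those counted by [rk v k m], and all n - k positions
    from k on. *)
Lemma rk_tail n (v : 'S_n) k m : k <= n -> m <= n ->
  (forall i : 'I_n, k <= i -> v i < m) -> rk v k m + (n - k) = m.
Proof.
move=> kn mn lt_m; rewrite -[RHS](rk_total v mn).
have -> : n - k = \sum_(i < n) (k <= i).
  rewrite -(big_mkord xpredT (fun i => (k <= i) : nat)) (big_cat_nat (n := k)) //=.
  rewrite big_nat big1 => [|i /andP[_ ik]]; last by rewrite leqNgt ik.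
  by rewrite big_nat (eq_bigr (fun=> 1)) => [|i /andP[-> _]] //;
    rewrite -big_nat sum_nat_const_nat muln1.
rewrite -big_split; apply: eq_bigr => i _ /=.
by rewrite ltn_ord; case: (ltnP i k) => [_ | /lt_m ->] //; rewrite addn0.
Qed.

Lemma inT_leq n (v w : 'S_n) J :
  inT v w J <-> (forall m, m < n -> rk w #|J| m <= cnt J m <= rk v #|J| m).
Proof.
split=> H m; first by move=> _; exact: H.
have [/H // | nm] := ltnP m n.
have Jn : #|J| <= n by rewrite -[n in _ <= n]card_ord max_card.
by rewrite !rk_top // cnt_card // leqnn.
Qed.

(** * Rank conditions after deletion of the largest value *)

Section Induced.

Variable n : nat.
Implicit Types (v w : 'S_n.+1) (X : {set 'I_n}).

Definition lift_set X : {set 'I_n.+1} := [set lift ord_max x | x in X].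

Lemma lift_max_val (x : 'I_n) : lift ord_max x = x :> nat.
Proof. by rewrite /= /bump leqNgt ltn_ord. Qed.

Lemma cnt_lift_set X m : cnt (lift_set X) m = cnt X m.
Proof.
rewrite /cnt big_imset /=; last by move=> x y _ _; exact: lift_inj.
by apply: eq_bigr => x _; rewrite /bump [n <= _]leqNgt ltn_ord.
Qed.

Lemma max_notin_lift X : ord_max \notin lift_set X.
Proof. by apply/imsetP => -[x _ /eqP]; rewrite (negPf (neq_lift _ _)). Qed.

Lemma card_lift_set X : #|lift_set X| = #|X|.
Proof. by rewrite card_imset //; exact: lift_inj. Qed.

Lemma cntU_lift_set X m : m <= n -> cnt (ord_max |: lift_set X) m = cnt X m.
Proof.
by move=> mn; rewrite cntU1 ?max_notin_lift // cnt_lift_set /= ltnNge mn.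
Qed.

Lemma cardU_lift_set X : #|ord_max |: lift_set X| = #|X|.+1.
Proof. by rewrite cardsU1 max_notin_lift card_lift_set. Qed.

Lemma lift_setP (J : {set 'I_n.+1}) :
  exists X, J = lift_set X \/ J = ord_max |: lift_set X.
Proof.
exists [set x | lift ord_max x \in J].
have E (y : 'I_n.+1) : y != ord_max ->
    (y \in lift_set [set x | lift ord_max x \in J]) = (y \in J).
  case: (unliftP ord_max y) => [x -> _ | ->]; last by rewrite eqxx.
  by rewrite mem_imset ?inE //; exact: lift_inj.
case: (boolP (ord_max \in J)) => MJ; [right | left]; apply/setP => y; rewrite ?inE.
  by case: eqVneq => [-> | /E ->].
by case: (eqVneq y ord_max) => [-> | /E ->] //; rewrite (negPf MJ) (negPf (max_notin_lift _)).
Qed.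

Lemma max_posK v : v (max_pos v) = ord_max.
Proof. by rewrite /max_pos permKV. Qed.

Lemma rk_induced v k m : m <= n -> rk (induced v) k m = rk v (bump (max_pos v) k) m.
Proof.
move=> mn; rewrite [RHS]/rk (bigD1_ord (max_pos v)) //= max_posK /=.
rewrite [n < m]ltnNge mn andbF add0n; apply: eq_bigr => i _.
rewrite -lift_induced_fun lift_max_val permE; congr (nat_of_bool (_ && _)).
by rewrite /= /bump; lia.
Qed.

Lemma rk_induced_high v k m : m <= n -> max_pos v <= k ->
  rk (induced v) k m = rk v k.+1 m.
Proof. by move=> mn pk; rewrite rk_induced // /bump pk. Qed.

Lemma rk_induced_low v k m : m <= n -> k <= max_pos v ->
  rk (induced v) k m = rk v k m.
Proof.
move=> mn kp; rewrite rk_induced // /bump leq_eqVlt.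
have [e | ne] /= := eqVneq (val (max_pos v)) k; last first.
  by rewrite ltnNge kp.
by rewrite -e add1n rkS max_posK /= [n < m]ltnNge mn addn0.
Qed.

Lemma rk_max v k : k <= n.+1 -> rk v k n + (max_pos v < k) = k.
Proof.
move=> kn; rewrite -[RHS](rk_top v kn (leqnn _)) /rk (bigD1_ord (max_pos v)) //=.
rewrite [in RHS](bigD1_ord (max_pos v)) //= max_posK /= ltnn ltnSn andbF andbT add0n.
rewrite addnC; congr (_ + _); apply: eq_bigr => i _.
by rewrite -lift_induced_fun lift_max_val ltn_ord (ltn_trans (ltn_ord _) (ltnSn n)).
Qed.

(** Stronger than the monotonicity in [compatible]: entries between the two maxima are compared with
    all earlier (for v) or later (for w) positions, also those outside the range. The positions of
    the maxima themselves, where v or w is largest, are left out. *)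
Definition top_records v w : Prop :=
  (forall k i : 'I_n.+1, max_pos w <= k < max_pos v -> i < k -> v i < v k) /\
  (forall k i : 'I_n.+1, max_pos w < k <= max_pos v -> k < i -> w i < w k).

(** Write k for [#|X|]. For k at most [max_pos v] the upper bounds agree. The lower bounds differ
    only for k beyond [max_pos w], where the induced permutation also counts position k; the record
    of w at k then makes the larger bound automatic. *)
Lemma inT_lift v w X : top_records v w ->
  inT v w (lift_set X) <->
  inT (induced v) (induced w) X /\ #|X| <= max_pos v.
Proof.
move=> [_ RL]; have Xn : #|X| <= n by rewrite -[n in _ <= n]card_ord max_card.
have cntE m : cnt (lift_set X) m = cnt X m by rewrite cnt_lift_set.
have low (H : #|X| <= max_pos v) m : m <= n ->
  (rk w #|X| m <= cnt X m) <-> (rk (induced w) #|X| m <= cnt X m).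
  move=> mn; have [Xp | pX] := leqP #|X| (max_pos w).
    by rewrite rk_induced_low.
  rewrite rk_induced_high //; last exact: ltnW.
  pose K := Ordinal (leq_ltn_trans Xn (ltnSn n)).
  have EK : val K = #|X| by [].
  have rkK : rk w #|X|.+1 m = rk w #|X| m + (w K < m) := rkS w K m.
  rewrite rkK; have [lt | ge] := ltnP (w K) m; last by rewrite addn0.
  have tail : forall i : 'I_n.+1, K.+1 <= i -> w i < m.
      by move=> i Ki; apply: ltn_trans (RL K i _ Ki) lt; rewrite /= pX H.
  (* All positions after k carry values below m, so the bound equals m - (n - k); a k-subset meets
     it because at most n - m of its elements are at least m. *)
  have := rk_tail (ltn_ord K) (leqW mn) tail; rewrite EK rkK lt.
  by have := cnt_lipschitz X m (n - m); rewrite subnKC // cnt_card //; lia.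
rewrite !inT_leq card_lift_set; split.
  (* At m = n the upper bound fails as soon as the largest value of v is among its first [#|X|]
     values. *)
  move=> H; have Xp : #|X| <= max_pos v.
    have := H n (ltnSn n); rewrite cntE cnt_card //.
    by have := rk_max v (leqW Xn); case: ltnP => //; lia.
  split=> // m mn; have := H m (ltn_trans mn (ltnSn n)); rewrite cntE.
  by case/andP => /(low Xp m (ltnW mn)) -> ; rewrite rk_induced_low // ltnW.
case=> H Xp m; rewrite ltnS leq_eqVlt cntE => /predU1P[-> | mn].
  rewrite cnt_card //; have := rk_max v (leqW Xn); have := rk_max w (leqW Xn).
  by rewrite [max_pos v < _]ltnNge Xp; lia.
have := H m mn; case/andP => /(low Xp m (ltnW mn)) ->.
by rewrite rk_induced_low // ltnW.
Qed.

(** Dual to [inT_lift]: now the upper bounds may differ, when k = [#|X|] lies before [max_pos v] and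
    v k < m. The record of v at k then puts all of the first k values below m, and both upper bounds
    hold trivially. *)
Lemma inT_liftU v w X : top_records v w ->
  inT v w (ord_max |: lift_set X) <->
  inT (induced v) (induced w) X /\ max_pos w <= #|X|.
Proof.
move=> [LR _]; have Xn : #|X| <= n by rewrite -[n in _ <= n]card_ord max_card.
have high (H : max_pos w <= #|X|) m : m <= n ->
  (cnt X m <= rk v #|X|.+1 m) <-> (cnt X m <= rk (induced v) #|X| m).
  move=> mn; have [pX | Xp] := leqP (max_pos v) #|X|.
    by rewrite rk_induced_high.
  rewrite rk_induced_low //; last exact: ltnW.
  pose K := Ordinal (leq_ltn_trans Xn (ltnSn n)).
  have rkK : rk v #|X|.+1 m = rk v #|X| m + (v K < m) := rkS v K m.
  rewrite rkK; have [lt | ge] := ltnP (v K) m; last by rewrite addn0.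
  have -> : rk v #|X| m = #|X|.
    apply: rk_full => [|i iK]; first exact: leqW.
    by apply: ltn_trans lt; apply: LR => //=; rewrite H Xp.
  by rewrite cnt_le_card (leq_trans (cnt_le_card X m)) // leq_addr.
rewrite !inT_leq cardU_lift_set; split.
  move=> H; have Xp : max_pos w <= #|X|.
    have := H n (ltnSn n); rewrite cntU_lift_set // cnt_card //.
    by have := rk_max w (k := #|X|.+1) Xn; case: ltnP => //; lia.
  split=> // m mn; have := H m (ltn_trans mn (ltnSn n)).
  rewrite cntU_lift_set ?(ltnW mn) //.
  by case/andP => le /(high Xp m (ltnW mn)) ->; rewrite rk_induced_high ?(ltnW mn) // le.
case=> H Xp m; rewrite ltnS leq_eqVlt => /predU1P[-> | mn].
  rewrite cntU_lift_set // cnt_card //.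
  have := rk_max v (k := #|X|.+1) Xn; have := rk_max w (k := #|X|.+1) Xn.
  by rewrite [max_pos w < _]ltnS Xp; lia.
rewrite cntU_lift_set ?(ltnW mn) //.
have := H m mn; case/andP => le /(high Xp m (ltnW mn)) ->.
by rewrite -rk_induced_high ?le ?(ltnW mn).
Qed.

End Induced.

(** * The exchange property forces records *)

Lemma leq_rk_r n (v : 'S_n) k m m' : m <= m' -> rk v k m <= rk v k m'.
Proof. by move=> mm'; rewrite -!cnt_first_values leq_cnt. Qed.

Lemma mem_first_values n (v : 'S_n) k (i : 'I_n) :
  (v i \in first_values v k) = (i < k).
Proof. by rewrite mem_imset ?inE //; exact: perm_inj. Qed.

(** The combinatorial trace of the three-term relations. The four sets are nonempty and proper
    automatically, each containing one of i, j, k and missing another. *)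
Definition exchange_closed n (v w : 'S_n) : Prop :=
  forall (S : {set 'I_n}) (i j k : 'I_n), i < j -> j < k ->
    i \notin S -> j \notin S -> k \notin S ->
    inT v w (i |: (k |: S)) -> inT v w (j |: S) ->
    inT v w (i |: S) /\ inT v w (j |: (k |: S)).

Lemma lt_ord_max n (x : 'I_n.+1) : (x < (ord_max : 'I_n.+1)) = (x != ord_max).
Proof. by rewrite ltn_neqAle (leq_ord x) andbT. Qed.

Lemma ord_max_ltF n m : m <= n -> ((ord_max : 'I_n.+1) < m) = false.
Proof. by move=> mn; rewrite ltnNge mn. Qed.

Section TopRecords.

Variables (n : nat) (v w : 'S_n.+1).
Hypothesis le_vw : forall k m, rk w k m <= rk v k m.

(** Compare the rank functions at m = n on the shortest initial segment that contains the largest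
    value of v. *)
Lemma leq_max_pos : max_pos w <= max_pos v.
Proof.
have := le_vw (max_pos v).+1 n; have := rk_max v (ltn_ord (max_pos v)).
by have := rk_max w (ltn_ord (max_pos v)); rewrite ltnSn ltnS; case: leqP => //; lia.
Qed.

Lemma inT_first_values k : k <= n.+1 -> inT v w (first_values v k).
Proof. by move=> kn m; rewrite card_first_values // cnt_first_values le_vw /=. Qed.

Lemma inT_first_values_w k : k <= n.+1 -> inT v w (first_values w k).
Proof. by move=> kn m; rewrite card_first_values // cnt_first_values le_vw leqnn. Qed.

Hypothesis closed_vw : exchange_closed v w.

(** Otherwise let j be the largest of the first k values, so v k < j, and let S be these values
    without j. The exchange for v k < j < [ord_max] puts [v k |: S] in T, but its count at m = j
    exceeds [rk v k j] by one. *)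
Lemma left_records (k i : 'I_n.+1) :
  max_pos w <= k < max_pos v -> i < k -> v i < v k.
Proof.
move=> /andP[pk kp] ik; rewrite ltnNge; apply/negP => le_ki.
have kn : k <= n.+1 by exact: ltnW.
case: (@arg_maxnP _ i (fun i : 'I_n.+1 => i < k) (fun i => v i) ik) => i1 i1k max_i1.
pose A := first_values v k; pose j := v i1; pose S := A :\ j.
have jA : j \in A by rewrite mem_first_values.
have lt_kj : v k < j.
  rewrite ltn_neqAle (leq_trans le_ki (max_i1 _ _)) // andbT.
  by rewrite (inj_eq val_inj) (inj_eq (@perm_inj _ v)) -(inj_eq val_inj) gtn_eqF.
have MA : ord_max \notin A.
  by rewrite -(max_posK v) mem_first_values -leqNgt ltnW.
have kA : v k \notin A by rewrite mem_first_values ltnn.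
have lt_jM : j < (ord_max : 'I_n.+1).
  by rewrite lt_ord_max; apply: contraNneq MA => <-.
have kS : v k \notin S by rewrite inE negb_and kA orbT.
have MS : ord_max \notin S by rewrite inE negb_and MA orbT.
have jS : j \notin S by rewrite !inE eqxx.
have cS m : rk v k m = (j < m) + cnt S m by rewrite -cnt_first_values (cntD1 _ jA).
have cA : #|S|.+1 = k :> nat.
  by have := card_first_values v kn; rewrite -/A (cardsD1 j) jA.
have defA : j |: S = A by rewrite setD1K.
have kMS : v k \notin ord_max |: S.
  by rewrite in_setU1 negb_or kS andbT; apply: contraTneq lt_kj => ->; rewrite -leqNgt ltnW.
have max_j (i2 : 'I_n.+1) : i2 < k -> v i2 <= j := @max_i1 i2.
clearbody S; clearbody j.
have [] // := closed_vw lt_kj lt_jM kS jS MS.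
- apply/inT_leq => m mn; rewrite cardsU1 kMS cardsU1 MS !cntU1 // ord_max_ltF //.
  rewrite add0n !add1n cA (rkS v) cS; apply/andP; split; last by case: (v k < m); lia.
  (* For m at most j the count is that of the first k + 1 values of v. Beyond j it is at least k,
     while [rk w k.+1 m] is at most k because the largest value of w is among its first k + 1. *)
  have [jm | mj] := ltnP j m; last first.
    by have := le_vw k.+1 m; rewrite (rkS v) cS ltnNge mj; case: (v k < m); lia.
  have full : rk v k m = k.
    by apply: rk_full => // i2 /max_j H; apply: leq_ltn_trans jm.
  have := rk_max w (ltn_ord k); rewrite ltnS pk => wk.
  have := leq_rk_r w k.+1 (n := n.+1) (m := m) (m' := n); rewrite cS in full.
  by lia.
- by rewrite defA; exact: inT_first_values.
move=> /(_ j) + _; rewrite cardsU1 kS add1n cA cntU1 // lt_kj cS ltnn; lia.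
Qed.

(** Otherwise let j be the largest value of w after position k, so w k < j, and let S be the first k
    + 1 values without w k and [ord_max]. The exchange puts [j |: (ord_max |: S)] in T, but its
    count at m = j is one less than [rk w k.+1 j]. *)
Lemma right_records (k i : 'I_n.+1) :
  max_pos w < k <= max_pos v -> k < i -> w i < w k.
Proof.
move=> /andP[pk kp] ki; rewrite ltnNge; apply/negP => le_ki.
case: (@arg_maxnP _ i (fun i : 'I_n.+1 => k < i) (fun i => w i) ki) => i1 ki1 max_i1.
pose B := first_values w k.+1; pose j := w i1; pose S := (B :\ w k) :\ ord_max.
have wkM : w k != ord_max.
  by rewrite -(max_posK w) (inj_eq (@perm_inj _ w)) -(inj_eq val_inj) gtn_eqF.
have kB : w k \in B by rewrite mem_first_values.
have MB : ord_max \in B :\ w k.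
  by rewrite !inE eq_sym wkM -(max_posK w) mem_first_values /= ltnW.
have lt_kj : w k < j.
  rewrite ltn_neqAle (leq_trans le_ki (max_i1 _ _)) // andbT.
  by rewrite (inj_eq val_inj) (inj_eq (@perm_inj _ w)) -(inj_eq val_inj) ltn_eqF.
have lt_jM : j < (ord_max : 'I_n.+1).
  rewrite lt_ord_max -(max_posK w) (inj_eq (@perm_inj _ w)).
  by rewrite -(inj_eq val_inj) gtn_eqF // (ltn_trans pk).
have kS : w k \notin S by rewrite !inE eqxx andbF.
have MS : ord_max \notin S by rewrite !inE eqxx.
have jS : j \notin S.
  by rewrite !inE mem_first_values ltnS leqNgt ki1 !andbF.
have kMS : w k \notin ord_max |: S by rewrite in_setU1 negb_or wkM.
have jMS : j \notin ord_max |: S.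
  by rewrite in_setU1 negb_or jS andbT -(inj_eq val_inj) ltn_eqF.
have defB : w k |: (ord_max |: S) = B by rewrite setD1K // setD1K.
have cS m : m <= n -> cnt S m = rk w k m.
  move=> mn; have := cnt_first_values w k.+1 m; rewrite -/B -defB rkS.
  by rewrite !cntU1 // ord_max_ltF //; case: (w k < m); lia.
have cB : #|S|.+1 = k :> nat.
  have := card_first_values w (ltn_ord k); rewrite -/B -defB cardsU1 kMS cardsU1 MS.
  by lia.
have max_j (i2 : 'I_n.+1) : k < i2 -> w i2 <= j := @max_i1 i2.
clearbody S; clearbody j.
have [] // := closed_vw lt_kj lt_jM kS jS MS.
- by rewrite defB; apply: inT_first_values_w.
- apply/inT_leq => m; rewrite ltnS => mn; rewrite cardsU1 jS add1n cB cntU1 // cS //.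
  (* Only the upper bound for m beyond j is delicate. There all values of w after k are below m,
     which determines [rk w k m], while the first k values of v avoid the largest one and so at most
     n - m of them are at least m. *)
  rewrite leq_addl /=; have [jm | mj] := ltnP j m; last exact: le_vw.
  have tail (i2 : 'I_n.+1) : k.+1 <= i2 -> w i2 < m.
    by move=> /max_j H; apply: leq_ltn_trans jm.
  have := rk_tail (ltn_ord k) (leqW mn) tail; rewrite rkS.
  have := rk_max v (ltnW (ltn_ord k)); rewrite [_ < k]ltnNge kp.
  have := cnt_lipschitz (first_values v k) m (n - m).
  by rewrite subnKC // !cnt_first_values (ltn_trans lt_kj jm); lia.
move=> _ /(_ j); rewrite cardsU1 jMS cardsU1 MS !add1n cB !cntU1 // ltnn.
by rewrite rkS lt_kj ord_max_ltF ?cS ?(ltnW lt_jM) //; lia.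
Qed.

Lemma exchange_top_records : top_records v w.
Proof. by split=> k i; [exact: left_records | exact: right_records]. Qed.

(** The first k values of [induced v], with [ord_max] adjoined when k exceeds [max_pos v], have the
    counts of an initial segment of v. They therefore lie in T, and the lower bound passes to the
    induced pair. *)
Lemma rk_induced_le k m : rk (induced w) k m <= rk (induced v) k m.
Proof.
have [nk | kn] := ltnP n k.
  have [mn | nm] := leqP m n; first by rewrite !(rk_ge _ _ (ltnW nk)) !rk_total.
  by rewrite !(rk_ge _ _ (ltnW nk)) !rk_top ?(ltnW nm).
suff: inT (induced v) (induced w) (first_values (induced v) k).
  by move=> /(_ m); rewrite card_first_values // cnt_first_values => /andP[].
have [kp | pk] := leqP k (max_pos v).
  suff /(inT_lift _ exchange_top_records)[] : inT v w (lift_set (first_values (induced v) k)).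
    by [].
  apply/inT_leq => m' lt; rewrite card_lift_set cnt_lift_set card_first_values //.
  by rewrite cnt_first_values rk_induced_low // le_vw leqnn.
suff /(inT_liftU _ exchange_top_records)[] :
    inT v w (ord_max |: lift_set (first_values (induced v) k)) by [].
apply/inT_leq => m' lt; rewrite cardU_lift_set cntU_lift_set // card_first_values //.
by rewrite cnt_first_values rk_induced_high ?(ltnW pk) // le_vw leqnn.
Qed.

(** All four sets are lifted in the same way: without [ord_max] if even the larger ones have at most
    [max_pos v] elements, and with it otherwise. In the second case even the smaller ones have at
    least [max_pos w] elements. *)
Lemma exchange_closed_induced : exchange_closed (induced v) (induced w).
Proof.
move=> S i j k ij jk iS jS kS T1 T2; pose l (x : 'I_n) : 'I_n.+1 := lift ord_max x.
have records := exchange_top_records.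
have lU x X : l x |: lift_set X = lift_set (x |: X) by rewrite /lift_set imsetU1.
have lM x X : l x |: (ord_max |: X) = ord_max |: (l x |: X) by rewrite setUCA.
have lN x (X : {set 'I_n}) : x \notin X -> l x \notin lift_set X.
  by rewrite mem_imset //; exact: lift_inj.
have lNM x (X : {set 'I_n}) : x \notin X -> l x \notin ord_max |: lift_set X.
  by move=> xX; rewrite in_setU1 negb_or lN // eq_sym neq_lift.
have lt (x y : 'I_n) : x < y -> l x < l y by rewrite /l !lift_max_val.
have ikS : i \notin k |: S.
  by rewrite in_setU1 negb_or iS andbT -(inj_eq val_inj) ltn_eqF // (ltn_trans ij).
have jkS : j \notin k |: S.
  by rewrite in_setU1 negb_or jS andbT -(inj_eq val_inj) ltn_eqF.
have [le_p | gt_p] := leqP (#|S|.+2) (max_pos v).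
  have := closed_vw (lt _ _ ij) (lt _ _ jk) (lN _ _ iS) (lN _ _ jS) (lN _ _ kS).
  rewrite !lU !inT_lift // !cardsU1 ikS kS jkS jS iS !add1n le_p (ltnW le_p).
  by move=> /(_ (conj T1 isT) (conj T2 isT)) [[? _] [? _]].
have := closed_vw (lt _ _ ij) (lt _ _ jk) (lNM _ _ iS) (lNM _ _ jS) (lNM _ _ kS).
have le_p' : max_pos w <= #|S|.+1 := leq_trans leq_max_pos gt_p.
rewrite !lM !lU !inT_liftU // !cardsU1 ikS kS jkS jS iS !add1n le_p' (leqW le_p').
by move=> /(_ (conj T1 isT) (conj T2 isT)) [[? _] [? _]].
Qed.

End TopRecords.

(** * Records imply compatibility *)

Lemma submax_posE n (v : 'S_n.+2) :
  submax_pos v = lift (max_pos v) (max_pos (induced v)).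
Proof.
apply: (@perm_inj _ v); rewrite /submax_pos permKV -lift_induced_fun.
have -> : induced_fun v (max_pos (induced v)) = ord_max.
  by have := max_posK (induced v); rewrite {1}/induced permE.
by apply: ord_inj; rewrite lift_max_val inordK.
Qed.

Lemma submax_posK n (v : 'S_n.+2) : v (submax_pos v) = n :> nat.
Proof. by rewrite /submax_pos permKV inordK. Qed.

Lemma lt_max_pos n (v : 'S_n.+1) (i : 'I_n.+1) : (v i < n) = (i != max_pos v).
Proof.
transitivity (v i != ord_max); first exact: lt_ord_max.
by rewrite -(max_posK v) (inj_eq (@perm_inj _ v)).
Qed.

(** The monotone runs are restrictions of the records. If the second largest value of w came after
    [max_pos v], the record there would exceed it and be the largest value, which sits elsewhere;
    dually for v. *)
Lemma compatibleP n (v w : 'S_n.+2) :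
  max_pos w <= max_pos v -> top_records v w -> compatible v w.
Proof.
rewrite leq_eqVlt /compatible => /predU1P[/val_inj -> | lt_p] [LR RL].
  by rewrite eqxx.
apply/orP; right; apply/and5P; split => //.
- rewrite leqNgt; apply/negP => lt; have := RL (max_pos v) _ _ lt.
  rewrite submax_posK lt_p leqnn => /(_ isT); apply/negP; rewrite -leqNgt -ltnS.
  by rewrite lt_max_pos -(inj_eq val_inj) gtn_eqF.
- rewrite leqNgt; apply/negP => lt; have := LR (max_pos w) _ _ lt.
  rewrite submax_posK lt_p leqnn => /(_ isT); apply/negP; rewrite -leqNgt -ltnS.
  by rewrite lt_max_pos -(inj_eq val_inj) ltn_eqF.
- apply/forallP => i; apply/forallP => j; apply/implyP => /and3P[pi ij jp].
  move: pi; rewrite leq_eqVlt => /predU1P[/val_inj ei | lt_i].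
    by rewrite -ei max_posK lt_max_pos -(inj_eq val_inj) gtn_eqF // ei.
  by apply: (RL _ _ _ ij); rewrite lt_i (leq_trans (ltnW ij)).
apply/forallP => i; apply/forallP => j; apply/implyP => /and3P[pi ij].
rewrite leq_eqVlt => /predU1P[/val_inj ej | lt_j].
  by rewrite ej max_posK lt_max_pos -(inj_eq val_inj) ltn_eqF // -ej.
by apply: (LR _ _ _ ij); rewrite lt_j (leq_trans pi (ltnW ij)).
Qed.

Lemma exchange_closed_calT n (v w : 'S_n.+1) :
  (forall k m, rk w k m <= rk v k m) -> exchange_closed v w -> calT v w.
Proof.
elim: n v w => [|n IH] v w le_vw closed_vw //.
apply/andP; split; last first.
  exact: compatibleP (leq_max_pos le_vw) (exchange_top_records le_vw closed_vw).
by apply: IH; [exact: rk_induced_le | exact: exchange_closed_induced].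
Qed.

(** * The intervals of pairs in calT are faces *)

Lemma lt_induced n (v : 'S_n.+1) (i j : 'I_n) :
  (induced v i < induced v j) = (v (lift (max_pos v) i) < v (lift (max_pos v) j)).
Proof. by rewrite -!lift_induced_fun !lift_max_val !permE. Qed.

(** The monotone runs reduce the claim to the end of the range: v at p' against earlier positions, w
    at p against later ones. There the induced pair has a record, or the entry is the second largest
    value. *)
Lemma calT_top_records n (v w : 'S_n.+1) : calT v w -> top_records v w.
Proof.
elim: n v w => [|n IH] v w.
  by move=> _; split=> k i; rewrite !ord1.
move=> /andP[/IH [LR RL] compat].
have [e | ne] := eqVneq (max_pos v) (max_pos w).
  by split=> k i; rewrite e; lia.
move: compat; rewrite /compatible (negPf ne) /= => /and5P[lt_p s'_p p'_s].
move=> /'forall_'forall_implyP desc /'forall_'forall_implyP asc.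
set p := max_pos v in lt_p s'_p desc asc *; set p' := max_pos w in lt_p p'_s desc asc *.
set q := max_pos (induced v) in LR RL; set q' := max_pos (induced w) in LR RL.
have sE : submax_pos v = bump p q :> nat by rewrite submax_posE.
have s'E : submax_pos w = bump p' q' :> nat by rewrite submax_posE.
split=> [k i | k i] /andP[pk kp] ik.
- have [p'i | ip'] := leqP p' i; first by apply: asc; rewrite p'i ik ltnW.
  suff lt_ip : v i < v p'.
    move: pk; rewrite leq_eqVlt => /predU1P[/val_inj <- //| pk].
    by apply: ltn_trans lt_ip (asc _ _ _); rewrite leqnn pk ltnW.
  (* Otherwise the second largest value of w would come after position p' + 1 in the decreasing run,
     below an entry that is not the largest. *)
  have le_q' : q' <= p'.
    rewrite leqNgt; apply/negP => lt_q.
    have lt1 : p'.+1 < n.+2 by have := ltn_ord p; lia.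
    have lt2 : p'.+1 < submax_pos w by rewrite s'E /bump; lia.
    have := desc (Ordinal lt1) (submax_pos w); rewrite submax_posK /= leqnSn lt2 s'_p.
    move=> /(_ isT); apply/negP; rewrite -leqNgt -ltnS lt_max_pos.
    by rewrite -(inj_eq val_inj) /= gtn_eqF.
  (* Both i and p' lie left of p, so they survive its deletion with unchanged indices. *)
  have [[i' ei] [P eP]] : (exists i', i = lift p i') /\ (exists P, p' = lift p P).
    split; [case: (unliftP p i) => [i' -> | e] | case: (unliftP p p') => [i' -> | e]];
      by [exists i' | move: lt_p ip' ; rewrite -?e; lia].
  have [vi vP] : i' = i :> nat /\ P = p' :> nat.
    have := congr1 val ei; have := congr1 val eP; move: ip' lt_p.
    by rewrite /= /bump; case: leqP; case: leqP; lia.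
  rewrite ei eP -lt_induced.
  have [lt_q | le_q] := ltnP p' q; first by apply: LR; rewrite vP ?vi // le_q' lt_q.
  (* Here q is at most p' < p, so the second largest value of v sits at q itself, and p' <= s leaves
     only p' = q. *)
  have -> : P = q.
    by apply: val_inj; rewrite /= vP; move: p'_s; rewrite sE /bump; lia.
  rewrite max_posK lt_max_pos -(inj_eq val_inj) ltn_eqF //=.
  rewrite vi -/q; move: p'_s; rewrite sE /bump [p <= q]leqNgt (leq_ltn_trans le_q lt_p).
  exact: leq_trans.
have [ip | pi] := leqP i p; first by apply: desc; rewrite ip ik ltnW.
suff lt_ip : w i < w p.
  move: kp; rewrite leq_eqVlt => /predU1P[/val_inj -> //| kp].
  by apply: ltn_trans lt_ip (desc _ _ _); rewrite leqnn kp ltnW.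
have lt_q' : q' < p.
  by move: s'_p; rewrite s'E /bump; case: leqP => //; lia.
have le_q : p <= q.+1.
  rewrite leqNgt; apply/negP => lt_q.
  have sq : submax_pos v = q :> nat by rewrite sE /bump leqNgt (ltnW lt_q).
  have lt1 : q.+1 < n.+2 by have := ltn_ord p; lia.
  have := asc (submax_pos v) (Ordinal lt1); rewrite submax_posK p'_s sq /= ltnSn ltnW //.
  move=> /(_ isT); apply/negP; rewrite -leqNgt -ltnS lt_max_pos.
  by rewrite -(inj_eq val_inj) /= ltn_eqF.
have [[i' ei] [P eP]] : (exists i', i = lift p' i') /\ (exists P, p = lift p' P).
  split; [case: (unliftP p' i) => [i' -> | e] | case: (unliftP p' p) => [i' -> | e]];
    by [exists i' | move: lt_p pi ; rewrite ?e; lia].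
(* Both i and p lie right of the deleted position p', so their indices drop by one. *)
have [vi vP] : i'.+1 = i :> nat /\ P.+1 = p :> nat.
  have := congr1 val ei; have := congr1 val eP; move: pi lt_p.
  by rewrite /= /bump; case: leqP; case: leqP; lia.
rewrite ei eP -lt_induced.
have lt_Pi : P < i' by move: pi; rewrite -vi -vP ltnS.
have [lt_P | le_P] := ltnP q' P.
  by apply: RL => //; rewrite lt_P -ltnS vP.
have ePq : P = q' by apply: val_inj; apply/eqP; rewrite eqn_leq le_P -ltnS vP.
by rewrite ePq max_posK lt_max_pos -/q' -ePq -(inj_eq val_inj) gtn_eqF.
Qed.

(** [cnt J] numbers the elements of J from 0 to [#|J|] - 1. This makes a bound on the cardinality
    linear in the diagonal exponents. *)
Lemma sum_cnt_eq n (J : {set 'I_n}) r : \sum_(x in J) (cnt J x == r) = (r < #|J|).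
Proof.
pose Jr := [set x in J | cnt J x == r].
transitivity #|Jr|.
  rewrite -sum1_card [RHS](eq_bigl (fun x => (x \in J) && (cnt J x == r))); last first.
    by move=> x; rewrite inE.
  by rewrite big_mkcondr; apply: eq_bigr => x _; case: eqP.
rewrite -(cnt_card Jr (leqnn n)) -(cnt_card J (leqnn n)).
have : forall m, m <= n -> cnt Jr m = (r < cnt J m); last by apply.
elim=> [|m IH] lt_mn.
  by rewrite /cnt !big1.
have := cntS J (Ordinal lt_mn); have := cntS Jr (Ordinal lt_mn) => /= -> ->.
rewrite IH ?(ltnW lt_mn) // inE /=; case: (_ \in J) => /=; last by rewrite !addn0.
by lia.
Qed.

Local Open Scope ring_scope.

Lemma calT_face n (v w : 'S_n.+1) : calT v w ->
  exists a : nat -> nat -> int, forall J : {set 'I_n.+1},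
    0 <= \sum_(x in J) a (cnt J x) x /\
    (inT v w J <-> \sum_(x in J) a (cnt J x) x = 0).
Proof.
elim: n v w => [|n IH] v w Tvw.
  exists (fun _ _ => 0) => J; rewrite big1 //; split=> //; split=> // _.
  by apply/inT_leq => -[|//] _; rewrite /rk /cnt !big1 // => i *; rewrite ?ltn0 ?andbF.
have records := calT_top_records Tvw.
have [a face_a] : exists a : nat -> nat -> int, forall J : {set 'I_n.+1},
    0 <= \sum_(x in J) a (cnt J x) x /\
    (inT (induced v) (induced w) J <-> \sum_(x in J) a (cnt J x) x = 0).
  by apply: IH; case/andP: Tvw.
pose p : nat := max_pos v; pose p' : nat := max_pos w.
(* The term for r = p sums to the indicator of p < [#|J|]. Without [ord_max] this penalises [#|X|] >
   p. With it, [ord_max] sits in row [#|X|], the term - (p <= r) cancels this indicator, and the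
   indicator of [#|X|] < p' remains: exactly the conditions of [inT_lift] and [inT_liftU]. *)
exists (fun r x => (if (x < n.+1)%N then a r x
                    else (r < p')%N%:Z - (p <= r)%N%:Z) + (r == p)%:Z) => J.
have sumZ : \sum_(x in J) (cnt J x == p)%:Z = (p < #|J|)%N%:Z.
  by rewrite -sum_cnt_eq -natz natr_sum; apply: eq_bigr => x _; rewrite natz.
have [X JX] := lift_setP J; have [ge0 face_X] := face_a X.
have sumX (F : nat -> nat -> int) (G : nat -> nat) :
    (forall m, (m < n.+1)%N -> G m = cnt X m) ->
    \sum_(x in lift_set X) (if (x < n.+1)%N then a (G x) x else F (G x) x)
    = \sum_(x in X) a (cnt X x) x.
  move=> GE; rewrite /lift_set big_imset /=; last by move=> x y _ _; exact: lift_inj.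
  by apply: eq_bigr => x _; rewrite /bump [(n.+1 <= x)%N]leqNgt ltn_ord add0n ltn_ord GE.
rewrite big_split /= sumZ; case: JX => ->.
  rewrite (sumX (fun r _ => (r < p')%N%:Z - (p <= r)%N%:Z)); last first.
    by move=> m _; rewrite cnt_lift_set.
  rewrite inT_lift // card_lift_set face_X; split; first by rewrite addr_ge0.
  by rewrite -/p; case: leqP; split; lia.
rewrite big_setU1 ?max_notin_lift //=.
rewrite (sumX (fun r _ => (r < p')%N%:Z - (p <= r)%N%:Z)); last first.
  by move=> m mn; rewrite cntU_lift_set // ltnW.
rewrite ltnn cntU_lift_set // cnt_card // cardU_lift_set inT_liftU // face_X ltnS.
rewrite -/p' [(p' <= _)%N]leqNgt; move: ge0; set s := \sum_(x in X) _.
by case: (#|X| < p')%N; case: (p <= #|X|)%N => ?; split=> //; try split; try case; lia.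
Qed.

Local Close Scope ring_scope.

(** * Initial forms of Plucker relations *)

(** s i is the number of j with s j < s i, that is, with j < i. *)
Lemma perm_no_inversion k (s : 'S_k) :
  (forall i j : 'I_k, i < j -> s i < s j) -> s = 1%g.
Proof.
move=> incr; apply/permP => i; apply: val_inj; rewrite perm1 /=.
rewrite -[LHS](rk_total s (ltnW (ltn_ord _))) -[RHS](rk_total 1%g (ltnW (ltn_ord i))).
apply: eq_bigr => j _; rewrite perm1; congr (nat_of_bool (_ && _)).
case: (ltngtP j i) => [/incr -> // | /incr lt | /val_inj ->]; last by rewrite ltnn.
by rewrite ltnNge ltnW.
Qed.

(** Undoing an inversion strictly lowers the sum, so only the identity can be a minimiser, and every
    other s is strictly above some sum. *)
Lemma rearrangement k (g : 'I_k -> nat) (s : 'S_k) :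
    (forall i j : 'I_k, i < j -> g j < g i) -> s != 1%g ->
  \sum_(i < k) i * g i < \sum_(i < k) i * g (s i).
Proof.
move=> decr; pose F (t : 'S_k) := \sum_(i < k) i * g (t i).
have swap (t : 'S_k) : t != 1%g -> exists t', F t' < F t.
  move=> t1; have /existsP[i /existsP[j /andP[ij tij]]] :
      [exists i : 'I_k, exists j : 'I_k, (i < j) && (t j < t i)].
    apply: contraNT t1; rewrite negb_exists => /forallP noinv.
    apply/eqP/perm_no_inversion => i j ij; have := noinv i; rewrite negb_exists => /forallP/(_ j).
    rewrite ij /= -leqNgt leq_eqVlt => /predU1P[/val_inj/perm_inj e|//].
    by rewrite e ltnn in ij.
  exists (tperm i j * t)%g; rewrite /F (bigD1 i) // (bigD1 j) /=; last first.
    by rewrite -(inj_eq val_inj) gtn_eqF.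
  rewrite [ltnRHS](bigD1 i) // [X in _ < _ + X](bigD1 j) /=; last first.
    by rewrite -(inj_eq val_inj) gtn_eqF.
  rewrite !permM tpermL tpermR !addnA.
  rewrite (eq_bigr (fun l : 'I_k => l * g (t l))) => [|l /andP[li lj]]; last first.
    by rewrite permM tpermD // eq_sym.
  by rewrite ltn_add2r; have := decr _ _ tij; nia.
have [t _ min_t] := @arg_minnP _ 1%g xpredT F isT.
have t1 : t = 1%g.
  by apply/eqP/negPn/negP => /swap[t' lt]; have := min_t t' isT; rewrite leqNgt lt.
move=> /swap[t' lt]; apply: leq_ltn_trans lt; have := min_t t' isT; rewrite t1.
by apply: leq_trans; apply: leq_sum => i _; rewrite perm1.
Qed.

Lemma cnt_nth_elts n (A : {set 'I_n}) r : r < #|A| -> cnt A (nth 0 (elts A) r) = r.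
Proof.
move=> rA; rewrite -count_elts.
have H r' := @ltn_count_sorted _ (nth 0 (elts A) r) r' (sorted_elts A).
apply/eqP; rewrite eqn_leq; apply/andP; split.
  by rewrite leqNgt H ltnn andbF.
case: r rA H => // r rA H; rewrite H size_elts (ltnW rA) /=.
by apply: (sorted_ltn_nth ltn_trans 0 (sorted_elts A)); rewrite ?inE ?size_elts // ltnW.
Qed.

Lemma nth_elts n (A : {set 'I_n}) (r : 'I_#|A|) : nth 0 (elts A) r = enum_val r.
Proof. by rewrite (nth_map (enum_default r)) // -cardE. Qed.

Lemma cnt_enum_val n (A : {set 'I_n}) (r : 'I_#|A|) : cnt A (enum_val r) = r.
Proof. by rewrite -nth_elts cnt_nth_elts. Qed.

Lemma enum_val_lt n (A : {set 'I_n}) (r q : 'I_#|A|) :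
  r < q -> enum_val r < enum_val q.
Proof.
move=> rq; rewrite ltnNge; apply/negP => /(leq_cnt A).
by rewrite !cnt_enum_val leqNgt rq.
Qed.

Lemma sum_enum_val n (A : {set 'I_n}) (F : 'I_n -> nat) :
  \sum_(r < #|A|) F (enum_val r) = \sum_(x in A) F x.
Proof. by rewrite [RHS]big_enum_val. Qed.

Lemma diag_monE n (J : psubset n) r (x : 'I_n) :
  diag_mon J (enum_rank (r, x)) = (x \in val J) && (cnt (val J) x == r) :> nat.
Proof.
rewrite /diag_mon mnm_sumE.
pose F (y : 'I_n) : nat := (y == x) && (cnt (val J) y == r).
transitivity (\sum_(y in val J) F y).
  transitivity (\sum_(q < #|val J|) F (enum_val q)); last first.
    exact: sum_enum_val.
  apply: eq_bigr => q _.
  rewrite mnm1E (inj_eq enum_rank_inj) /F cnt_enum_val andbC.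
  by rewrite xpair_eqE -(inj_eq val_inj).
rewrite /F; have [xJ | xJ] := boolP (x \in val J).
  rewrite (bigD1 x) //= eqxx big1 ?addn0 // => y /andP[_ /negPf ->] //.
by rewrite big1 // => y yJ; case: eqP => // e; rewrite -e yJ in xJ.
Qed.

Local Open Scope ring_scope.

(** * Substitutions, weights and lowest terms *)

Section Subst.

Variables (K : comNzRingType) (I I' : finType).
Implicit Type h : I -> {fpoly K[I']}.

Lemma psubstX h (m : 'X_{1..#|I|}) :
  psubst h 'X_[m] = \prod_(i : I) h i ^+ m (enum_rank i).
Proof.
rewrite /psubst comp_mpolyX (reindex enum_rank) /=; last first.
  exact: onW_bij (enum_rank_bij I).
by apply: eq_bigr => i _; rewrite tnth_mktuple enum_rankK.
Qed.

Lemma psubstE h f :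
  psubst h f = \sum_(m <- msupp f) f@_m *: psubst h 'X_[m].
Proof. exact: comp_mpolyEX. Qed.

Lemma psubstD h f g : psubst h (f + g) = psubst h f + psubst h g.
Proof. exact: rmorphD. Qed.

Lemma psubstM h f g : psubst h (f * g) = psubst h f * psubst h g.
Proof. exact: rmorphM. Qed.

Lemma psubstZ h c f : psubst h (c *: f) = c *: psubst h f.
Proof. exact: comp_mpolyZ. Qed.

Lemma psubst_sum h T (r : seq T) (F : T -> {fpoly K[I]}) :
  psubst h (\sum_(x <- r) F x) = \sum_(x <- r) psubst h (F x).
Proof. exact: raddf_sum. Qed.

Lemma psubst_ideal_gen h (G : {fpoly K[I]} -> Prop) f :
  (forall g, G g -> psubst h g = 0) -> ideal_gen G f -> psubst h f = 0.
Proof.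
move=> hG [s [sG ->]]; rewrite psubst_sum big_seq big1 // => c /sG /hG.
by rewrite psubstM => ->; rewrite mulr0.
Qed.

End Subst.

Lemma psubst_comp (K : comNzRingType) (I I' I'' : finType)
    (h' : I' -> {fpoly K[I'']}) (h : I -> {fpoly K[I']}) f :
  psubst h' (psubst h f) = psubst (psubst h' \o h) f.
Proof.
rewrite (psubstE h f) psubst_sum [RHS]psubstE; apply: eq_bigr => m _.
rewrite psubstZ !psubstX /psubst rmorph_prod; congr (_ *: _).
by apply: eq_bigr => i _; rewrite rmorphXn.
Qed.

Section Weight.

Variables (K : comNzRingType) (I : finType) (wt : I -> nat).
Implicit Types (p q : {fpoly K[I]}) (m : 'X_{1..#|I|}).

Lemma mon_weightD m1 m2 :
  mon_weight wt (m1 + m2) = (mon_weight wt m1 + mon_weight wt m2)%N.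
Proof. by rewrite /mon_weight -big_split; apply: eq_bigr => i _; rewrite mnmDE mulnDl. Qed.

Lemma mon_weight0 : mon_weight wt 0%MM = 0%N.
Proof. by rewrite /mon_weight big1 // => i _; rewrite mnm0E. Qed.

Lemma mon_weightU i : mon_weight wt U_(enum_rank i)%MM = wt i.
Proof.
rewrite /mon_weight (bigD1 i) //= mnm1E eqxx mul1n big1 ?addn0 // => j ji.
by rewrite mnm1E (inj_eq enum_rank_inj) eq_sym (negPf ji).
Qed.

Lemma mon_weight_sum T (r : seq T) (F : T -> 'X_{1..#|I|}) :
  mon_weight wt (\sum_(x <- r) F x)%MM = (\sum_(x <- r) mon_weight wt (F x))%N.
Proof. exact: (big_morph _ mon_weightD mon_weight0). Qed.

Lemma mon_weightMn m k : mon_weight wt (m *+ k)%MM = (k * mon_weight wt m)%N.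
Proof. by rewrite /mon_weight big_distrr; apply: eq_bigr => i _; rewrite /= mulmnE mulnA mulnC [(m _ * k)%N]mulnC mulnC. Qed.

Definition weight_geq c p := forall m, m \in msupp p -> (c <= mon_weight wt m)%N.

Lemma weight_geq0 c : weight_geq c 0.
Proof. by move=> m; rewrite msupp0. Qed.

Lemma weight_geqD c p q : weight_geq c p -> weight_geq c q -> weight_geq c (p + q).
Proof. by move=> pc qc m /msuppD_le; rewrite mem_cat => /orP[/pc | /qc]. Qed.

Lemma weight_geqN c p : weight_geq c p -> weight_geq c (- p).
Proof. by move=> pc m; rewrite (perm_mem (msuppN p)) => /pc. Qed.

Lemma weight_geqX m : weight_geq (mon_weight wt m) 'X_[m].
Proof. by move=> m'; rewrite msuppX inE => /eqP ->. Qed.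

Lemma weight_geqM c d p q :
  weight_geq c p -> weight_geq d q -> weight_geq (c + d) (p * q).
Proof.
move=> pc qd m /msuppM_le /allpairsP[[m1 m2] [/= /pc ? /qd ? ->]].
by rewrite mon_weightD leq_add.
Qed.

Lemma weight_geqW c d p : (d <= c)%N -> weight_geq c p -> weight_geq d p.
Proof. by move=> dc pc m /pc; apply: leq_trans. Qed.

Lemma weight_geq_sum c T (r : seq T) (P : pred T) (F : T -> {fpoly K[I]}) :
  (forall x, P x -> weight_geq c (F x)) -> weight_geq c (\sum_(x <- r | P x) F x).
Proof.
by move=> Fc; apply: (big_ind (weight_geq c)) => [|p q|//]; [exact: weight_geq0 | exact: weight_geqD].
Qed.

(** The monomial has coefficient one and all other terms are strictly heavier, a property that is
    stable under products. *)
Definition lowest_term m p := weight_geq (mon_weight wt m).+1 (p - 'X_[m]).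

Lemma lowest_term_geq m p : lowest_term m p -> weight_geq (mon_weight wt m) p.
Proof.
move=> pm; rewrite -[p](subrK 'X_[m]); apply: weight_geqD; last exact: weight_geqX.
by apply: weight_geqW pm.
Qed.

Lemma lowest_term1 : lowest_term 0%MM 1.
Proof. by rewrite /lowest_term mpolyX0 subrr; exact: weight_geq0. Qed.

Lemma lowest_termM m1 m2 p q :
  lowest_term m1 p -> lowest_term m2 q -> lowest_term (m1 + m2)%MM (p * q).
Proof.
move=> pm qm; rewrite /lowest_term mpolyXD mon_weightD.
have -> : p * q - 'X_[m1] * 'X_[m2] = (p - 'X_[m1]) * q + 'X_[m1] * (q - 'X_[m2]).
  by rewrite mulrBl mulrBr addrA subrK.
apply: weight_geqD; first by rewrite -addSn; exact: weight_geqM (lowest_term_geq qm).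
by rewrite -addnS; apply: weight_geqM qm; exact: weight_geqX.
Qed.

Lemma lowest_termX m p k : lowest_term m p -> lowest_term (m *+ k)%MM (p ^+ k).
Proof.
move=> pm; elim: k => [|k IH]; first by rewrite expr0 mulm0n; exact: lowest_term1.
by rewrite exprS mulmS; exact: lowest_termM.
Qed.

Lemma mcoeff_lowest m p e : lowest_term m p ->
  (mon_weight wt e <= mon_weight wt m)%N -> p@_e = (m == e)%:R.
Proof.
move=> pm le_em; rewrite -[p](subrK 'X_[m]) mcoeffD mcoeffX memN_msupp_eq0 ?add0r //.
by apply/negP => /pm; rewrite ltnNge le_em.
Qed.

Lemma mcoeff_initial_form p m :
  (initial_form wt p)@_m =
  if all (fun m' => mon_weight wt m <= mon_weight wt m')%N (msupp p) then p@_m else 0.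
Proof.
rewrite /initial_form raddf_sum /=; case: ifPn => [low | /negbTE nlow]; last first.
  rewrite big1 // => m' low; rewrite mcoeffZ mcoeffX.
  by case: eqP low => [-> | _]; rewrite ?mulr0 // nlow.
have [ms | ms] := boolP (m \in msupp p); last first.
  rewrite (memN_msupp_eq0 ms) big1_seq // => m' /andP[_ m's].
  by rewrite mcoeffZ mcoeffX; case: eqP m's ms => [-> -> //| _ _ _]; rewrite mulr0.
rewrite -big_filter (bigD1_seq m) ?filter_uniq ?msupp_uniq ?mem_filter ?low //=.
rewrite mcoeffZ mcoeffX eqxx mulr1 big1 ?addr0 // => m' /negPf m'm.
by rewrite mcoeffZ mcoeffX m'm mulr0.
Qed.

End Weight.

Section Initial.

Variables (K : comNzRingType) (n : nat).

Definition row_monomial (m : 'X_{1..#|{: psubset n}|}) : 'X_{1..#|{: 'I_n.-1 * 'I_n}|} :=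
  (\sum_(J : psubset n) diag_mon J *+ m (enum_rank J))%MM.

Definition diag_map : {fpoly K[psubset n]} -> {fpoly K['I_n.-1 * 'I_n]} :=
  psubst (fun J => 'X_[diag_mon J]).

Lemma diag_mapX m : diag_map 'X_[m] = 'X_[row_monomial m].
Proof. by rewrite /diag_map psubstX mprodXnE. Qed.

Lemma weight_row_monomial m :
  mon_weight (@Mweight n) (row_monomial m) = mon_weight (@plucker_weight n) m.
Proof. by rewrite mon_weight_sum; apply: eq_bigr => J _; rewrite mon_weightMn. Qed.

(** The Leibniz term of s has weight the sum of r * (n - c), with c the column chosen in row r by s.
    Columns increase, so the second factor decreases and [rearrangement] singles out the
    identity. *)
Lemma plucker_minor_lowest (J : psubset n) :
  lowest_term (@Mweight n) (diag_mon J) (plucker_minor K J).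
Proof.
pose U (s : 'S_#|val J|) : 'X_{1..#|{: 'I_n.-1 * 'I_n}|} :=
  (\sum_(r < #|val J|) U_(enum_rank (prow r, pcol (s r))))%MM.
have wU (s : 'S_#|val J|) : mon_weight (@Mweight n) (U s) =
    (\sum_(r < #|val J|) r * (n - enum_val (s r)))%N.
  by rewrite mon_weight_sum; apply: eq_bigr => r _; rewrite mon_weightU.
have prodU (s : 'S_#|val J|) : \prod_r mxsub (@prow n J) (@pcol n J) (xmatrix K n) r (s r) = 'X_[U s].
  by rewrite -mprodXE; apply: eq_bigr => r _; rewrite !mxE.
rewrite /lowest_term /plucker_minor /determinant (bigD1 1%g) //= odd_perm1 mul1r.
have diagU : diag_mon J = U 1%g by apply: eq_bigr => r _; rewrite perm1.
rewrite prodU -diagU addrAC subrr add0r; apply: weight_geq_sum => s s1.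
rewrite prodU -signr_odd; apply: (@weight_geqW _ _ _ (mon_weight (@Mweight n) (U s))).
  rewrite diagU !wU; under [X in (X < _)%N]eq_bigr do rewrite perm1.
  apply: rearrangement s1 => r q /enum_val_lt lt_rq.
  by apply: ltn_sub2l => //; apply: ltn_trans lt_rq _.
by case: odd; rewrite ?expr0 ?expr1 ?mul1r ?mulN1r; [apply: weight_geqN|];
   exact: weight_geqX.
Qed.

Lemma plucker_map_lowest m :
  lowest_term (@Mweight n) (row_monomial m) (plucker_map ('X_[m] : {fpoly K[psubset n]})).
Proof.
rewrite /plucker_map psubstX /row_monomial.
apply: (big_ind2 (fun a b => lowest_term (@Mweight n) a b)).
- exact: lowest_term1.
- by move=> *; exact: lowest_termM.
by move=> J _; apply/lowest_termX/plucker_minor_lowest.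
Qed.

(** An exponent e hit by a lowest monomial of f has the same coefficient here as in [plucker_map f],
    because heavier monomials contribute only above the weight of e. Hence the initial ideal lies in
    the kernel of the diagonal map. *)
Lemma diag_map_initial_form (f : {fpoly K[psubset n]}) :
  plucker_map f = 0 -> diag_map (initial_form (@plucker_weight n) f) = 0.
Proof.
move=> f0; set low := fun m => all (fun m' => mon_weight (@plucker_weight n) m <=
  mon_weight (@plucker_weight n) m')%N (msupp f).
have mapE : diag_map (initial_form (@plucker_weight n) f) =
    \sum_(m <- msupp f | low m) f@_m *: 'X_[row_monomial m].
  rewrite /diag_map /initial_form -big_filter psubst_sum big_filter.
  by apply: eq_bigr => m _; rewrite psubstZ -/(diag_map _) diag_mapX.
apply/mpolyP => e; rewrite mcoeff0 mapE raddf_sum /=.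
have [/hasP[m0 m0f /andP[low0 /eqP e0]] | none] :=
    boolP (has (fun m => low m && (row_monomial m == e)) (msupp f)); last first.
  rewrite big1_seq // => m /andP[lowm mf]; rewrite mcoeffZ mcoeffX.
  case: eqP => [e'|]; last by rewrite mulr0.
  by case/hasP: none; exists m; rewrite // lowm e' eqxx.
rewrite -[RHS](mcoeff0 _ e) -f0 /plucker_map psubstE raddf_sum /= big_mkcond.
rewrite !big_seq; apply: eq_bigr => m mf; rewrite !mcoeffZ.
have le_m : (mon_weight (@Mweight n) e <= mon_weight (@Mweight n) (row_monomial m))%N.
  by rewrite -e0 !weight_row_monomial; have /allP := low0; exact.
rewrite (mcoeff_lowest (@plucker_map_lowest m) le_m) mcoeffX.
case: ifPn => // /allPn[m' m'f]; rewrite -ltnNge => lt_m.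
case: eqP => [em|]; last by rewrite mulr0.
move: lt_m; rewrite -!weight_row_monomial em -e0 !weight_row_monomial ltnNge.
by have /allP/(_ _ m'f) -> := low0.
Qed.

Lemma diag_map_initial_ideal (f : {fpoly K[psubset n]}) :
  initial_plucker_ideal f -> diag_map f = 0.
Proof.
by apply: psubst_ideal_gen => g [h h0 ->]; exact: diag_map_initial_form.
Qed.

End Initial.

(** * Faces give monomial-free restrictions *)

Section Face.

Variables (K : comNzRingType) (n : nat) (T : {set psubset n}).
Variable a : nat -> nat -> int.

Definition entry_weight (e : 'X_{1..#|{: 'I_n.-1 * 'I_n}|}) : int :=
  \sum_(ij : 'I_n.-1 * 'I_n) a ij.1 ij.2 *+ e (enum_rank ij).

Lemma entry_weightD e1 e2 :
  entry_weight (e1 + e2)%MM = entry_weight e1 + entry_weight e2.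
Proof.
by rewrite /entry_weight -big_split; apply: eq_bigr => ij _; rewrite mnmDE mulrnDr.
Qed.

Lemma entry_weight0 : entry_weight 0%MM = 0.
Proof. by rewrite /entry_weight big1 // => ij _; rewrite mnm0E. Qed.

Lemma entry_weightMn e k : entry_weight (e *+ k)%MM = entry_weight e *+ k.
Proof.
elim: k => [|k IH]; first by rewrite mulm0n mulr0n entry_weight0.
by rewrite mulmS mulrS entry_weightD IH.
Qed.

Lemma entry_weight_diag (J : psubset n) :
  entry_weight (diag_mon J) = \sum_(x in val J) a (cnt (val J) x) x.
Proof.
rewrite (big_morph _ entry_weightD entry_weight0) [RHS]big_enum_val.
apply: eq_bigr => r _; rewrite cnt_enum_val /entry_weight.
rewrite (bigD1 (prow r, pcol r)) //= mnm1E eqxx mulr1n big1 ?addr0 // => ij ne.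
by rewrite mnm1E (inj_eq enum_rank_inj) eq_sym (negPf ne).
Qed.

Hypothesis face_ge0 : forall J : psubset n, 0 <= entry_weight (diag_mon J).
Hypothesis face_eq0 : forall J : psubset n, (J \in T) = (entry_weight (diag_mon J) == 0).

Definition face_map : {fpoly K[psubset n]} -> {fpoly K['I_n.-1 * 'I_n]} :=
  psubst (fun J => if J \in T then 'X_[diag_mon J] else 0).

(** A sum of nonnegative weights vanishes exactly when every variable that occurs has weight zero,
    that is, lies in T. Survival of a monomial is thus read off its diagonal image. *)
Lemma face_mapX m :
  face_map 'X_[m] =
  if entry_weight (row_monomial m) == 0 then 'X_[row_monomial m] else 0.
Proof.
rewrite /face_map psubstX /row_monomial (big_morph _ entry_weightD entry_weight0).
under [X in if X == _ then _ else _]eq_bigr do rewrite entry_weightMn.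
rewrite psumr_eq0 => [|J _]; last by rewrite mulrn_wge0.
case: ifPn => [/allP face | /allPn[J _ /= nface]].
  rewrite -mprodXnE; apply: eq_bigr => J _; rewrite face_eq0.
  have := face J (mem_index_enum _); rewrite /= mulrn_eq0.
  by case/orP => [/eqP -> | ->] //; rewrite !expr0.
move: nface; rewrite mulrn_eq0 negb_or => /andP[mJ nface].
by rewrite (bigD1 J) //= face_eq0 (negPf nface) expr0n (negPf mJ) mul0r.
Qed.

(** [face_map] is [diag_map] followed by the deletion of all terms of nonzero entry weight. *)
Lemma face_map_eq0 f : diag_map f = 0 -> face_map f = 0.
Proof.
move=> f0; apply/mpolyP => e; rewrite mcoeff0 /face_map psubstE raddf_sum /=.
have [e0 | ne0] := eqVneq (entry_weight e) 0.
  transitivity (diag_map f)@_e; last by rewrite f0 mcoeff0.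
  rewrite /diag_map psubstE raddf_sum /=.
  apply: eq_bigr => m _; rewrite !mcoeffZ.
  have := face_mapX m; have := diag_mapX K m; rewrite /face_map /diag_map => -> ->.
  case: ifPn => // nface; rewrite mcoeff0 mcoeffX.
  by case: eqP => // em; rewrite em e0 eqxx in nface.
rewrite big1 // => m _; rewrite mcoeffZ; have := face_mapX m; rewrite /face_map => ->.
case: ifPn => [/eqP m0|]; last by rewrite mcoeff0 mulr0.
rewrite mcoeffX; case: eqP => [em|_]; last by rewrite mulr0.
by rewrite -em m0 eqxx in ne0.
Qed.

(** Restriction followed by the diagonal map is [face_map], which kills the initial ideal, whereas
    the diagonal map sends every monomial to a monomial. *)
Lemma face_monomial_free : monomial_free (restrict (@initial_plucker_ideal K n) T).
Proof.
move=> m; pose h (j : {J : psubset n | J \in T}) : {fpoly K['I_n.-1 * 'I_n]} :=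
  'X_[diag_mon (val j)].
move=> /(psubst_ideal_gen (h := h)) => m0.
have {m0}: psubst h 'X_[m] = 0.
  apply: m0 => _ [f /diag_map_initial_ideal/face_map_eq0 f0 ->].
  rewrite /restrict_poly psubst_comp -[RHS]f0 /face_map /psubst.
  congr (_ \mPo _); apply: eq_mktuple => r /=; case: insubP => [j jT ej | /negPf ->].
    by rewrite -/(psubst h _) psubst_pvar jT /h ej.
  by rewrite raddf0.
rewrite psubstX mprodXnE => /mpolyP/(_ _); set e := (\sum_(i <- _) _)%MM.
move=> /(_ e)/eqP; rewrite mcoeffX eqxx mcoeff0 oner_eq0 //.
Qed.

End Face.

Lemma calT_monomial_free (K : comNzRingType) n (v w : 'S_n.+1) : calT v w ->
  monomial_free (restrict (@initial_plucker_ideal K n.+1) (Tset v w)).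
Proof.
move=> /calT_face[a face_a]; apply: (face_monomial_free (a := a)) => J.
  by rewrite entry_weight_diag; have [] := face_a (val J).
rewrite entry_weight_diag; have [_ inTE] := face_a (val J).
by apply/idP/eqP => [/TsetP/inTE | /inTE/TsetP].
Qed.

(** * Three-term Plucker relations *)

Section Minor.

Variables (R : comNzRingType) (C : eqType) (x0 : C) (Y : nat -> C -> R).
Implicit Types (s t : seq C).

Definition minor_mx k (f : nat -> C) : 'M[R]_k := \matrix_(r, q) Y r (f q).

(** Columns are given by a sequence, so they may be unsorted or repeated; rows are the first
    [size s] ones. *)
Definition minor s : R := \det (minor_mx (size s) (nth x0 s)).

Lemma minor_perm s t : perm_eq s t -> exists b : bool, minor s = (-1) ^+ b * minor t.
Proof.
move=> st; have sz := perm_size st.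
have /tuple_permP[p defs] : perm_eq s (in_tuple t) by [].
exists (p^-1)%g; rewrite /minor sz.
have -> : minor_mx (size t) (nth x0 s) = col_perm p (minor_mx (size t) (nth x0 t)).
  apply/matrixP => r q; rewrite !mxE defs; congr (Y r _).
  by rewrite -tnth_nth tnth_mktuple (tnth_nth x0).
by rewrite col_permE det_mulmx det_perm mulrC.
Qed.

Lemma minor_dup x s : x \in s -> minor (x :: s) = 0.
Proof.
move=> xs; have lt_i : (index x s < size s)%N by rewrite index_mem.
rewrite /minor -det_tr.
apply: (@determinant_alternate _ _ _ ord0 (lift ord0 (Ordinal lt_i))) => //.
by move=> r; rewrite !mxE /= nth_index.
Qed.

Lemma minor_linear s : exists c : nat -> R,
  forall x, minor (x :: s) = \sum_(r < (size s).+1) c r * Y r x.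
Proof.
(* The leading [x0] is a placeholder: the cofactors along the first column delete it. *)
exists (fun r => cofactor (minor_mx (size s).+1 (nth x0 (x0 :: s))) (inord r) ord0) => x.
rewrite /minor (expand_det_col _ ord0); apply: eq_bigr => r _.
rewrite !mxE /= mulrC inord_val; congr (_ * _); rewrite /cofactor.
by congr (_ * \det _); apply/matrixP => i j; rewrite !mxE.
Qed.

(* The row x |-> minor (x :: s) is a combination of the rows Y 0, .., Y (size s),
   so bordering the columns a, b, c, s with it gives a zero determinant, which
   is then expanded along that row. *)
Lemma minor_three_term a b c s :
  minor (a :: s) * minor (b :: c :: s) - minor (b :: s) * minor (a :: c :: s)
  + minor (c :: s) * minor (a :: b :: s) = 0.
Proof.
set k := size s; pose col q := nth x0 [:: a, b, c & s] q.
have [C' minorE] := minor_linear s.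
pose N : 'M[R]_k.+3 :=
  \matrix_(r, q) if (r < k.+2)%N then Y r (col q) else minor (col q :: s).
pose M : 'M[R]_k.+3 := \matrix_(r, q) if (r < k.+2)%N then Y r (col q) else 0.
pose B : 'M[R]_k.+3 := \matrix_(r, q)
  if (r < k.+2)%N then (r == q)%:R else if (q < k.+1)%N then C' q else 0.
have detN : \det N = 0.
  have -> : N = B *m M.
    apply/matrixP => r q; rewrite !mxE; case: ltnP => rk.
      rewrite (bigD1 r) //= !mxE rk eqxx mul1r big1 ?addr0 // => r' r'r.
      by rewrite !mxE rk eq_sym (negPf r'r) mul0r.
    have rkF : (r < k.+2)%N = false by rewrite ltnNge rk.
    rewrite minorE [RHS]big_ord_recr [in RHS]big_ord_recr /= !mxE rkF /= ltnn.
    rewrite [(_ < k.+1)%N]ltnNge leqnSn /= !mul0r !addr0.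
    apply: eq_bigr => i _; rewrite !mxE rkF /=.
    by rewrite ltn_ord (ltn_trans (ltn_ord i)).
  rewrite det_mulmx (expand_det_row M ord_max) big1 ?mulr0 // => q _.
  by rewrite mxE ltnn mul0r.
have lastN q : N ord_max q = minor (col q :: s) by rewrite mxE ltnn.
have cofN (q : 'I_k.+3) t : size t = k.+2 ->
    (forall i, (i < k.+2)%N -> col (bump q i) = nth x0 t i) ->
    cofactor N ord_max q = (-1) ^+ (k.+2 + q) * minor t.
  move=> st colE; rewrite /cofactor /minor st; congr (_ * \det _).
  by apply/matrixP => i j; rewrite !mxE lift_max ltn_ord -(colE j (ltn_ord j)).
have {detN} := detN; rewrite (expand_det_row N ord_max) !big_ord_recl /=.
(* For a column taken from s the minor in the last row has a repeated column, so only a, b and c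
   contribute. *)
rewrite !lastN big1 => [|q _]; last first.
  by rewrite lastN (_ : col _ = nth x0 s q) // minor_dup ?mul0r // mem_nth.
rewrite (cofN _ [:: b, c & s]) // (cofN _ [:: a, c & s]) //; last by case.
rewrite (cofN _ [:: a, b & s]) //; last by case=> [|[]].
rewrite /col /= !addnS addn0 !exprS.
rewrite addr0 => H; set e := (-1) ^+ k in H.
have ee : e * e = 1 by rewrite -[X in _ * X]mulr1 signrMK.
set lhs := LHS; have <- : e * e * lhs = lhs by rewrite ee mul1r.
by rewrite -mulrA -[RHS](mulr0 e) -[in RHS]H /lhs; ring.
Qed.

End Minor.

Lemma psubset_exists n (A : {set 'I_n}) x y :
  x \in A -> y \notin A -> exists J : psubset n, val J = A.
Proof.
move=> xA yA; suff PA : (A != set0) && (A \proper [set: 'I_n]) by exists (Sub A PA).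
apply/andP; split; first by apply/set0Pn; exists x.
by rewrite properT; apply: contraNneq yA => ->; rewrite inE.
Qed.

Lemma row_monomialD n (m1 m2 : 'X_{1..#|{: psubset n}|}) :
  row_monomial (m1 + m2)%MM = (row_monomial m1 + row_monomial m2)%MM.
Proof.
rewrite /row_monomial -big_split; apply: eq_bigr => J _ /=.
by apply/mnmP => e; rewrite !(mnmDE, mulmnE) mulnDr.
Qed.

Lemma row_monomialU n (J : psubset n) : row_monomial U_(enum_rank J)%MM = diag_mon J.
Proof.
rewrite /row_monomial (bigD1 J) //= big1 => [|J' J'J].
  by apply/mnmP => e; rewrite mnmDE mulmnE mnm1E eqxx muln1 mnm0E addn0.
by apply/mnmP => e; rewrite mulmnE mnm1E (inj_eq enum_rank_inj) eq_sym (negPf J'J) muln0 mnm0E.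
Qed.

Section ThreeTerm.

Variables (K : comNzRingType) (n : nat).

(** Rows are indexed by plain numbers to fit [minor]; the value 0 is only a default outside the
    matrix. *)
Definition xentry (r : nat) (x : 'I_n.+1) : {fpoly K['I_n.+1.-1 * 'I_n.+1]} :=
  if insub r is Some r' then pvar K (r', x) else 0.

Lemma plucker_minorE (J : psubset n.+1) :
  plucker_minor K J = minor ord0 xentry (enum (val J)).
Proof.
rewrite /minor -cardE; congr (\det _); apply/matrixP => r q; rewrite !mxE /xentry.
by rewrite (valK (prow r) : insub (val r) = _) /pcol (enum_val_nth ord0).
Qed.

(** The sign of the sorting permutation is kept only as a scalar e with e * e = 1, hence nonzero and
    its own inverse in every characteristic. *)
Lemma minor_plucker s (J : psubset n.+1) : uniq s -> s =i val J ->
  exists2 e : K, e * e = 1 & minor ord0 xentry s = e *: plucker_minor K J.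
Proof.
move=> us sJ; have : perm_eq s (enum (val J)).
  by apply: uniq_perm => //; [exact: enum_uniq | move=> x; rewrite mem_enum sJ].
case/(minor_perm ord0 xentry) => b ->; exists ((-1) ^+ b).
  by rewrite -expr2 sqrr_sign.
by rewrite plucker_minorE scaler_sign mulr_sign.
Qed.

Lemma plucker_three_term (S : {set 'I_n.+1}) (i j k : 'I_n.+1)
    (A1 A2 B1 B2 C1 C2 : psubset n.+1) :
    i != j -> i != k -> j != k -> i \notin S -> j \notin S -> k \notin S ->
    val A1 = i |: S -> val A2 = j |: (k |: S) ->
    val B1 = j |: S -> val B2 = i |: (k |: S) ->
    val C1 = k |: S -> val C2 = i |: (j |: S) ->
  exists e1 e2 e3 : K, [/\ e1 * e1 = 1, e2 * e2 = 1, e3 * e3 = 1 &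
    plucker_map (e1 *: (pvar K A1 * pvar K A2) + e2 *: (pvar K B1 * pvar K B2)
                 + e3 *: (pvar K C1 * pvar K C2)) = 0].
Proof.
move=> ij ik jk iS jS kS vA1 vA2 vB1 vB2 vC1 vC2.
have E1 x (J : psubset n.+1) : x \notin S -> val J = x |: S ->
    exists2 e : K, e * e = 1 & minor ord0 xentry (x :: enum S) = e *: plucker_minor K J.
  move=> xS vJ; apply: minor_plucker; first by rewrite /= mem_enum xS enum_uniq.
  by move=> y; rewrite vJ !inE mem_enum.
have E2 x y (J : psubset n.+1) : x != y -> x \notin S -> y \notin S -> val J = x |: (y |: S) ->
    exists2 e : K, e * e = 1 & minor ord0 xentry (x :: y :: enum S) = e *: plucker_minor K J.
  move=> xy xS yS vJ; apply: minor_plucker.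
    by rewrite /= inE negb_or xy !mem_enum xS yS enum_uniq.
  by move=> z; rewrite vJ !inE mem_enum.
have [a1 a1e mA1] := E1 _ _ iS vA1; have [a2 a2e mA2] := E2 _ _ _ jk jS kS vA2.
have [b1 b1e mB1] := E1 _ _ jS vB1; have [b2 b2e mB2] := E2 _ _ _ ik iS kS vB2.
have [c1 c1e mC1] := E1 _ _ kS vC1; have [c2 c2e mC2] := E2 _ _ _ ij iS jS vC2.
exists (a1 * a2), (- (b1 * b2)), (c1 * c2); split.
- by rewrite mulrACA a1e a2e mulr1.
- by rewrite mulrNN mulrACA b1e b2e mulr1.
- by rewrite mulrACA c1e c2e mulr1.
have := minor_three_term ord0 xentry i j k (enum S).
rewrite mA1 mA2 mB1 mB2 mC1 mC2 -!scalerAl -!scalerAr !scalerA => <-.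
by rewrite /plucker_map !psubstD !psubstZ !psubstM !psubst_pvar scaleNr.
Qed.

End ThreeTerm.

(** * Diagonal monomials of the three products *)

Section Exchange.

Variables (n : nat) (S : {set 'I_n}) (i j k : 'I_n).
Variables (A1 A2 B1 B2 C1 C2 : psubset n).
Hypotheses (ij : (i < j)%N) (jk : (j < k)%N).
Hypotheses (iS : i \notin S) (jS : j \notin S) (kS : k \notin S).
Hypotheses (vA1 : val A1 = i |: S) (vA2 : val A2 = j |: (k |: S)).
Hypotheses (vB1 : val B1 = j |: S) (vB2 : val B2 = i |: (k |: S)).
Hypotheses (vC1 : val C1 = k |: S) (vC2 : val C2 = i |: (j |: S)).

Let neq_ij : i != j. Proof. by rewrite -(inj_eq val_inj) ltn_eqF. Qed.
Let neq_jk : j != k. Proof. by rewrite -(inj_eq val_inj) ltn_eqF. Qed.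
Let neq_ik : i != k. Proof. by rewrite -(inj_eq val_inj) ltn_eqF // (ltn_trans ij). Qed.
Let ikS : i \notin k |: S. Proof. by rewrite in_setU1 negb_or neq_ik. Qed.
Let ijS : i \notin j |: S. Proof. by rewrite in_setU1 negb_or neq_ij. Qed.
Let jkS : j \notin k |: S. Proof. by rewrite in_setU1 negb_or neq_jk. Qed.

(** An x in S moves down one row for each adjoined element below it. The shifts in the two factors
    are the same up to order on both sides, being swapped when i < x < j, and each of i, j, k has
    the same row on both sides. *)
Lemma exchange_diag_mon : (diag_mon A1 + diag_mon A2 = diag_mon B1 + diag_mon B2)%MM.
Proof.
apply/mnmP => e; rewrite -[e]enum_valK; case: (enum_val e) => r x.
rewrite !mnmDE !diag_monE vA1 vA2 vB1 vB2 !in_setU1 !cntU1 //.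
set s := cnt S x; rewrite -!(inj_eq val_inj) /=.
have [xS | xS] := boolP (x \in S).
  have [xi xj xk] : [/\ x != i :> nat, x != j :> nat & x != k :> nat].
    by split; rewrite (inj_eq val_inj); apply: contraTneq xS => ->.
  rewrite !orbT /=; case: (ltngtP i x) xi => // ix _; case: (ltngtP j x) xj => // jx _;
    case: (ltngtP k x) xk => // kx _; rewrite ?add0n ?add1n //;
    solve [by rewrite addnC | by exfalso; clear -ij jk ix jx kx; lia].
rewrite !orbF; case: (ltngtP i x) => ix; case: (ltngtP j x) => jx;
  case: (ltngtP k x) => kx; rewrite /= ?add0n ?add1n //;
  solve [by rewrite addnC | by exfalso; clear -ij jk ix jx kx; lia].
Qed.

(** The variable in row [cnt S j] and column j divides the diagonal monomial of [A2], but not those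
    of [C1], which misses j, and [C2], where i pushes j one row down. *)
Lemma exchange_diag_mon_neq :
  (diag_mon C1 + diag_mon C2 != diag_mon A1 + diag_mon A2)%MM.
Proof.
have lt_r : (cnt S j < n.-1)%N.
  have := psubset_card B2; rewrite vB2 cardsU1 ikS cardsU1 kS.
  by have := cnt_le_card S j; lia.
have neq_ji : (j == i) = false by rewrite eq_sym (negPf neq_ij).
apply/eqP => /mnmP/(_ (enum_rank (Ordinal lt_r, j))).
rewrite !mnmDE !diag_monE vA1 vA2 vC1 vC2 !in_setU1 !cntU1 // (negPf jS) eqxx.
rewrite ltnn ij [(k < j)%N]ltnNge (ltnW jk) /= neq_ji (negPf neq_jk) /=.
by rewrite !add0n eqxx add1n eqn_leq ltnn.
Qed.

Lemma exchange_pair_neq :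
  (U_(enum_rank A1) + U_(enum_rank A2) != U_(enum_rank B1) + U_(enum_rank B2))%MM.
Proof.
have A1B1 : A1 != B1.
  by apply: contraNneq ijS => e; rewrite -vB1 -e vA1 setU11.
have A1B2 : A1 != B2.
  apply: contraNneq kS => e; have : k \in val B2 by rewrite vB2 !inE eqxx orbT.
  by rewrite -e vA1 in_setU1 eq_sym (negPf neq_ik).
apply/eqP => /mnmP/(_ (enum_rank A1)); rewrite !mnmDE !mnm1E eqxx.
by rewrite !(inj_eq enum_rank_inj) ![_ == A1]eq_sym (negPf A1B1) (negPf A1B2).
Qed.

End Exchange.

Lemma sqr1_neq0 (K : nzRingType) (e : K) : e * e = 1 -> e != 0.
Proof. by move=> ee; apply: contra_eq_neq ee => ->; rewrite mul0r eq_sym oner_neq0. Qed.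

(* The initial form lies in the kernel of the diagonal map, so a relation
   between three monomials, only two of which have the same image, has these
   two as its initial form. *)
Lemma three_term_initial_form (K : comNzRingType) n (mA mB mC : 'X_{1..#|{: psubset n}|})
    (e1 e2 e3 : K) (f := e1 *: 'X_[mA] + e2 *: 'X_[mB] + e3 *: 'X_[mC]) :
    row_monomial mA = row_monomial mB -> row_monomial mC != row_monomial mA ->
    mA != mB -> e1 != 0 -> e2 != 0 -> e3 != 0 -> plucker_map f = 0 ->
  initial_form (@plucker_weight n) f = e1 *: 'X_[mA] + e2 *: 'X_[mB].
Proof.
move=> dAB dCA neAB e1n0 e2n0 e3n0 f0.
have neAC : mA != mC by apply: contraNneq dCA => ->.
have neBC : mB != mC by apply: contraNneq dCA => <-; rewrite dAB.
have fE m : f@_m = e1 * (mA == m)%:R + e2 * (mB == m)%:R + e3 * (mC == m)%:R.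
  by rewrite !mcoeffD !mcoeffZ !mcoeffX.
pose wt m := mon_weight (@plucker_weight n) m.
pose low m := all (fun m' => wt m <= wt m')%N (msupp f).
pose c m (e : K) := if low m then e else 0.
have gE : initial_form (@plucker_weight n) f =
    c mA e1 *: 'X_[mA] + c mB e2 *: 'X_[mB] + c mC e3 *: 'X_[mC].
  apply/mpolyP => m; rewrite mcoeff_initial_form -/(low m) fE !mcoeffD !mcoeffZ !mcoeffX.
  have cE m' e : c m' e * (m' == m)%:R = if low m then e * (m' == m)%:R else 0.
    by case: eqP => [->|_]; rewrite /c ?mulr0 ?if_same //; case: ifP; rewrite ?mul0r.
  by rewrite !cE; case: ifP; rewrite ?addr0.
(* Otherwise the coefficient of [row_monomial mC] in the diagonal image would be the nonzero
   [e3]. *)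
have lowC : ~~ low mC.
  have := diag_map_initial_form f0; rewrite gE => /mpolyP/(_ (row_monomial mC)).
  rewrite /diag_map !psubstD !psubstZ -![psubst _ _]/(diag_map _) !diag_mapX.
  rewrite !mcoeffD !mcoeffZ !mcoeffX mcoeff0 eqxx -dAB eq_sym (negPf dCA).
  by rewrite !mulr0 !add0r mulr1 /c; apply: contra_eqN => ->.
have suppE m : m \in msupp f -> [|| m == mA, m == mB | m == mC].
  rewrite mcoeff_msupp fE; apply: contraNT; rewrite !negb_or ![m == _]eq_sym.
  by case/and3P => /negPf -> /negPf -> /negPf ->; rewrite !mulr0 !addr0.
have wtAB : wt mA = wt mB by rewrite /wt -!weight_row_monomial dAB.
(* Some monomial of f is lighter than [mC]; it is [mA] or [mB], which have equal weight. *)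
have lt_AC : (wt mA < wt mC)%N.
  have /allPn[m /suppE/or3P[]/eqP -> ] := lowC; rewrite -ltnNge ?ltnn //.
  by rewrite wtAB.
have lowA : low mA.
  by apply/allP => m /suppE/or3P[]/eqP ->; rewrite ?wtAB // -wtAB ltnW.
have lowB : low mB.
  by apply/allP => m /suppE/or3P[]/eqP ->; rewrite -?wtAB // ltnW.
by rewrite gE /c lowA lowB (negPf lowC) scale0r addr0.
Qed.

(** If [A1] or [A2] were outside T, restriction would kill their product in the binomial initial
    form and leave a unit times the monomial of [B1] and [B2]. *)
Lemma monomial_free_exchange_closed (K : comNzRingType) n (v w : 'S_n.+1) :
  monomial_free (restrict (@initial_plucker_ideal K n.+1) (Tset v w)) ->
  exchange_closed v w.
Proof.
move=> free S i j k ij jk iS jS kS TB2 TB1.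
have ne_ij : i != j by rewrite -(inj_eq val_inj) ltn_eqF.
have ne_jk : j != k by rewrite -(inj_eq val_inj) ltn_eqF.
have ne_ik : i != k by rewrite -(inj_eq val_inj) ltn_eqF // (ltn_trans ij).
have E1 x y : x != y -> y \notin S -> exists J : psubset n.+1, val J = x |: S.
  move=> xy yS; apply: (@psubset_exists _ _ x y); first exact: setU11.
  by rewrite in_setU1 negb_or eq_sym xy.
have E2 x y z : x != z -> y != z -> z \notin S ->
    exists J : psubset n.+1, val J = x |: (y |: S).
  move=> xz yz zS; apply: (@psubset_exists _ _ x z); first exact: setU11.
  by rewrite !in_setU1 !negb_or ![z == _]eq_sym xz yz.
have [A1 vA1] := E1 _ _ ne_ij jS.
have [B1 vB1] := E1 _ _ ne_jk kS.
have [C1 vC1] : exists J : psubset n.+1, val J = k |: S by apply: E1 jS; rewrite eq_sym.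
have [A2 vA2] : exists J : psubset n.+1, val J = j |: (k |: S).
  by apply: E2 iS; rewrite eq_sym.
have [B2 vB2] : exists J : psubset n.+1, val J = i |: (k |: S).
  by apply: E2 jS; rewrite // eq_sym.
have [C2 vC2] := E2 _ _ _ ne_ik ne_jk kS.
have [/andP[/TsetP TA1 /TsetP TA2] | TA] :=
    boolP ((A1 \in Tset v w) && (A2 \in Tset v w)).
  by rewrite -vA1 -vA2.
have {TB1} TB1 : B1 \in Tset v w by apply/TsetP; rewrite vB1.
have {TB2} TB2 : B2 \in Tset v w by apply/TsetP; rewrite vB2.
have [e1 [e2 [e3 [e1e e2e e3e f0]]]] := plucker_three_term K ne_ij ne_ik ne_jk iS jS kS
  vA1 vA2 vB1 vB2 vC1 vC2.
move: f0; rewrite /pvar -!mpolyXD => f0.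
have rm J J' : row_monomial (U_(enum_rank J) + U_(enum_rank J'))%MM =
    (diag_mon J + diag_mon J')%MM :> 'X_{1..#|{: 'I_n.+1.-1 * 'I_n.+1}|}.
  by rewrite row_monomialD !row_monomialU.
have := three_term_initial_form _ _ _ _ _ _ f0; rewrite !rm.
move=> /(_ (exchange_diag_mon ij jk iS jS kS vA1 vA2 vB1 vB2)).
move=> /(_ (exchange_diag_mon_neq ij jk iS jS kS vA1 vA2 vB2 vC1 vC2)).
move=> /(_ (exchange_pair_neq A2 ij jk iS kS vA1 vB1 vB2)).
move=> /(_ (sqr1_neq0 e1e) (sqr1_neq0 e2e) (sqr1_neq0 e3e)) in_f.
case: (free (U_(enum_rank (Sub B1 TB1)) + U_(enum_rank (Sub B2 TB2)))%MM).
set g := initial_form _ _ in in_f.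
have Ig : initial_plucker_ideal g.
  exists [:: (1, g)]; split; last by rewrite big_seq1 mul1r.
  by move=> c; rewrite inE => /eqP ->; exists (e1 *: (pvar K A1 * pvar K A2) +
    e2 *: (pvar K B1 * pvar K B2) + e3 *: (pvar K C1 * pvar K C2));
    rewrite /pvar -!mpolyXD.
pose memT (J : psubset n.+1) := J \in Tset v w.
(* The factor [e2] cancels the coefficient [e2] of the surviving term, since [e2] squares to one. *)
exists [:: (e2%:MP, restrict_poly (Tset v w) g)]; split.
  by move=> c; rewrite inE => /eqP ->; exists g.
rewrite big_seq1 /= in_f !mpolyXD -!/(pvar K _) /restrict_poly psubstD !psubstZ !psubstM.
rewrite !psubst_pvar (insubT memT TB1) (insubT memT TB2) mul_mpolyC scalerDr !scalerA e2e scale1r.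
have -> : (if insub A1 is Some J then pvar K J else 0) *
  (if insub A2 is Some J then pvar K J else 0) = 0 :> {fpoly K[{J | J \in Tset v w}]}.
  by move: TA; rewrite negb_and => /orP[] TA; rewrite (@insubN _ memT _ _ TA) ?mul0r ?mulr0.
by rewrite scaler0 add0r.
Qed.

Theorem theorem4p1 (K : closedFieldType) (n : nat) (n_ge1 : (1 <= n)%N)
    (v w : 'S_n) (le_vw : bruhat_le v w) :
  monomial_free (restrict (@initial_plucker_ideal K n) (Tset v w))
  <-> calT v w.
Proof.
case: n n_ge1 v w le_vw => // n _ v w /bruhatP le_vw; split.
  by move=> /monomial_free_exchange_closed; exact: exchange_closed_calT.
exact: calT_monomial_free.
Qed.
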